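(* Let $G$ be a finite simple graph on the vertex set $[n]$ and suppose $G=G_1\cup G_2$, where $G_1,G_2$ are induced subgraphs of $G$ with $V(G_1)\cap V(G_2)=\{v\}$ and $v$ is a free vertex of both $G_1$ and $G_2$. Let $S=K[x_j,y_j : j\in[n]]$ and $S_i=K[x_j,y_j : j\in V(G_i)]$ for $i=1,2$. Then $$\operatorname{Hilb}_{S/J_G}(t)=(1-t)^2\,\operatorname{Hilb}_{S_1/J_{G_1}}(t)\,\operatorname{Hilb}_{S_2/J_{G_2}}(t).$$ In particular, $\dim(S/J_G)=\dim(S_1/J_{G_1})+\dim(S_2/J_{G_2})-2$ and $e(S/J_G)=e(S_1/J_{G_1})\,e(S_2/J_{G_2})$.
   Context: $K$ is a field and all polynomial rings are standard graded. For a finite simple graph $\Gamma$ (with totally ordered vertex set), the binomial edge ideal of $\Gamma$ is $J_\Gamma=(x_iy_j-x_jy_i : \{i,j\}\in E(\Gamma),\ i<j)$ in $K[x_v,y_v : v\in V(\Gamma)]$. $G=G_1\cup G_2$ means $V(G)=V(G_1)\cup V(G_2)$ and $E(G)=E(G_1)\cup E(G_2)$. A vertex is free in a graph if it belongs to exactly one maximal clique of that graph. $\operatorname{Hilb}_M(t)=\sum_{k\ge0}\dim_K(M_k)t^k$ is the Hilbert series, $\dim$ is Krull dimension, and $e(M)$ is the multiplicity: if $\operatorname{Hilb}_M(t)=Q(t)/(1-t)^d$ with $d=\dim M$ and $Q$ a polynomial, then $e(M)=Q(1)$. *)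

(* Defs.v *)
From HB Require Import structures.
From mathcomp Require Import all_boot all_order all_algebra.
From mathcomp Require Import ring_quotient boolp mpoly.

Set Implicit Arguments.
Unset Strict Implicit.
Unset Printing Implicit Defensive.

Import GRing.Theory.
Local Open Scope ring_scope.
Local Open Scope quotient_scope.

Record sgraph (n : nat) := SGraph {
  vset : {set 'I_n};
  adj : rel 'I_n;
  adj_sym : ssrbool.symmetric adj;
  adj_irr : irreflexive adj;
  adj_vset : forall i j, adj i j -> (i \in vset) && (j \in vset)
}.

Section Graphs.
Variable n : nat.
Implicit Types G H : sgraph n.

Definition induced_subgraph H G :=
  vset H \subset vset G /\
  forall i j, adj H i j = [&& i \in vset H, j \in vset H & adj G i j].

Definition is_union G G1 G2 :=
  vset G = vset G1 :|: vset G2 /\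
  forall i j, adj G i j = adj G1 i j || adj G2 i j.

Definition clique G (C : {set 'I_n}) :=
  (C \subset vset G) && [forall i in C, forall j in C, (i != j) ==> adj G i j].

Definition free_vertex G (v : 'I_n) :=
  #|[set C : {set 'I_n} | maxset (clique G) C & v \in C]| == 1%N.

End Graphs.

Section IdealGen.
Variables (R : comNzRingType) (s : seq R).

Definition ideal_gen : {pred R} :=
  fun p => `[< exists c : 'I_(size s) -> R, p = \sum_i c i * s`_i >].

Lemma ideal_genP p :
  reflect (exists c : 'I_(size s) -> R, p = \sum_i c i * s`_i)
          (p \in ideal_gen).
Proof. exact: asboolP. Qed.

Lemma ideal_gen_closed : 1 \notin ideal_gen -> idealr_closed ideal_gen.
Proof.
move=> s1; split=> // [|a u v /ideal_genP[c ->] /ideal_genP[d ->]].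
  apply/ideal_genP; exists (fun=> 0).
  by rewrite big1 // => i _; rewrite mul0r.
apply/ideal_genP; exists (fun i => a * c i + d i).
rewrite mulr_sumr -big_split /=; apply: eq_bigr => i _.
by rewrite mulrDl mulrA.
Qed.

End IdealGen.

Section QuotLmodule.
Variables (K : fieldType) (m : nat) (I : idealr {mpoly K[m]}).
Local Notation A := {ideal_quot I}.

Definition quot_scale (c : K) (a : A) : A := \pi_A c%:MP * a.

Fact quot_scaleA a b v : quot_scale a (quot_scale b v) = quot_scale (a * b) v.
Proof. by rewrite /quot_scale mulrA -rmorphM -mpolyCM. Qed.
Fact quot_scale1 : left_id 1 quot_scale.
Proof. by move=> v; rewrite /quot_scale rmorph1 mul1r. Qed.
Fact quot_scaleDr : right_distributive quot_scale +%R.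
Proof. by move=> a u v; rewrite /quot_scale mulrDr. Qed.
Fact quot_scaleDl v : {morph quot_scale^~ v : a b / a + b}.
Proof. by move=> a b; rewrite /quot_scale mpolyCD rmorphD mulrDl. Qed.

HB.instance Definition _ := GRing.Zmodule_isLmodule.Build K A
  quot_scaleA quot_scale1 quot_scaleDr quot_scaleDl.

Lemma pi_scale (c : K) (p : {mpoly K[m]}) : \pi_A (c *: p) = c *: \pi_A p.
Proof. by rewrite -mul_mpolyC rmorphM. Qed.

End QuotLmodule.

Section Dim.
Variables (K : fieldType) (V : lmodType K).
Implicit Type U : V -> Prop.

Definition is_dim U (d : nat) := exists b : 'I_d -> V,
  [/\ forall i, U (b i),
      forall c : 'I_d -> K, \sum_i c i *: b i = 0 -> forall i, c i = 0
    & forall u, U u -> exists c : 'I_d -> K, u = \sum_i c i *: b i].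

Lemma span_is_dim U d (b : 'I_d -> V) :
    (forall i, U (b i)) ->
    (forall u, U u -> exists c : 'I_d -> K, u = \sum_i c i *: b i) ->
  exists e, is_dim U e.
Proof.
elim: d b => [|d IHd] b Ub spb; first by exists 0%N, b; split=> // c _ [].
have [free_b|] :=
  pselect (forall c, \sum_i c i *: b i = 0 -> forall i, c i = 0).
  by exists d.+1, b.
move=> /existsNP[c /not_implyP[sc0 /existsNP[j /eqP cj0]]].
apply: (IHd (b \o lift j)) => [i|u /spb[a ->]]; first exact: Ub.
exists (fun i => a (lift j i) - a j / c j * c (lift j i)).
move/eqP: sc0; rewrite (bigD1_ord j) //= addrC addr_eq0 => /eqP sc.
rewrite (bigD1_ord j) //=.
under [RHS]eq_bigr do rewrite scalerBl -scalerA.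
by rewrite sumrB -scaler_sumr sc scalerN opprK scalerA divfK // addrC.
Qed.

End Dim.

Section Hilbert.
Variables (K : fieldType) (m : nat) (I : idealr {mpoly K[m]}).
Local Notation A := {ideal_quot I}.

(* The degree [k] component of [S/I], for [I] homogeneous and [S] standard
   graded. *)
Definition graded_part (k : nat) (a : A) : Prop :=
  exists2 p : {mpoly K[m]}, p \is k.-homog & a = \pi_A p.

Lemma graded_part_dim k : exists d, is_dim (graded_part k) d.
Proof.
pose T := [pred t : 'X_{1..m < k.+1} | mdeg t == k].
apply: (@span_is_dim K A _ #|T| (fun i => \pi_A 'X_[bmnm (enum_val i)]))
  => [i|_ [p p_hom ->]].
  by exists 'X_[bmnm (enum_val i)] => //; rewrite dhomogX; exact: enum_valP i.
exists (fun i => p@_(bmnm (enum_val i))).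
rewrite -(@big_enum_val _ _ _ _ T (fun t => p@_(bmnm t) *: \pi_A 'X_[bmnm t])).
rewrite -[in LHS](pihomog_dE p_hom) (pihomogwE mdeg k (k := k.+1)); last first.
  rewrite mmeasureE; apply/bigmax_leqP_seq => t tp _.
  by rewrite (dhomog_mf p_hom).
rewrite raddf_sum.
by apply: eq_bigr => t _; exact: pi_scale.
Qed.

Definition hilbert_fun (k : nat) : nat := projT1 (cid (graded_part_dim k)).

Lemma hilbert_funP k : is_dim (graded_part k) (hilbert_fun k).
Proof. exact: projT2 (cid (graded_part_dim k)). Qed.

End Hilbert.

Definition fps := nat -> int.

Definition fps_of_poly (Q : {poly int}) : fps := fun k => Q`_k.

Definition fps_mul (f g : fps) : fps :=
  fun k => \sum_(i < k.+1) f i * g (k - i)%N.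

Definition hilbert_series (K : fieldType) (m : nat) (I : idealr {mpoly K[m]}) :
  fps := fun k => (hilbert_fun I k)%:Z.

Definition prime_chain (R : comNzRingType) (l : nat)
    (P : 'I_l.+1 -> prime_idealr R) :=
  forall i j : 'I_l.+1, (i < j)%N ->
    {subset P i <= P j} /\ ~ {subset P j <= P i}.

Definition is_krull_dim (R : comNzRingType) (d : nat) :=
  (exists P : 'I_d.+1 -> prime_idealr R, prime_chain P) /\
  (forall l (P : 'I_l.+1 -> prime_idealr R), prime_chain P -> (l <= d)%N).

Lemma is_krull_dim_uniq (R : comNzRingType) (d d' : nat) :
  is_krull_dim R d -> is_krull_dim R d' -> d = d'.
Proof.
move=> [[P cP] maxd] [[P' cP'] maxd']; apply/eqP.
by rewrite eqn_leq (maxd' _ _ cP) (maxd _ _ cP').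
Qed.

(* Hilb(t) = Q(t) / (1 - t)^d is written (1 - t)^d Hilb(t) = Q(t). *)
Definition is_multiplicity (K : fieldType) (m : nat) (I : idealr {mpoly K[m]})
    (e : int) :=
  exists (d : nat) (Q : {poly int}),
  [/\ is_krull_dim {ideal_quot I} d,
      fps_mul (fps_of_poly ((1 - 'X) ^+ d)) (hilbert_series I) = fps_of_poly Q
    & e = Q.[1]].

Lemma is_multiplicity_uniq (K : fieldType) (m : nat)
    (I : idealr {mpoly K[m]}) (e e' : int) :
  is_multiplicity I e -> is_multiplicity I e' -> e = e'.
Proof.
move=> [d [Q [dimd hQ ->]]] [d' [Q' [dimd' hQ' ->]]].
move: hQ'; rewrite -(is_krull_dim_uniq dimd dimd') hQ => QQ'.
suff -> : Q = Q' by [].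
by apply/polyP => k; exact: (congr1 (fun f : fps => f k) QQ').
Qed.

Section BinomialEdgeIdeal.
Variables (K : fieldType) (n : nat) (G : sgraph n).

(* The index [k : 'I_#|vset G|] stands for the vertex [enum_val k]; the first
   block of variables is that of the x's and the second that of the y's. *)
Definition bei_ring : comNzRingType := {mpoly K[#|vset G| + #|vset G|]}.

Definition xvar (k : 'I_#|vset G|) : bei_ring := 'X_(lshift _ k).
Definition yvar (k : 'I_#|vset G|) : bei_ring := 'X_(rshift _ k).

Definition bei_gens : seq bei_ring :=
  [seq xvar kl.1 * yvar kl.2 - xvar kl.2 * yvar kl.1
     | kl <- enum [pred kl : 'I_#|vset G| * 'I_#|vset G|
         | (enum_val kl.1 < enum_val kl.2)%N
           && adj G (enum_val kl.1) (enum_val kl.2)]].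

Definition bei : {pred bei_ring} := ideal_gen bei_gens.

Fact bei_proper : 1 \notin bei.
Proof.
apply/ideal_genP => -[c] /(congr1 (meval (fun=> 0))) /eqP.
rewrite rmorph1 rmorph_sum big1 ?oner_eq0 // => i _.
have /mapP[kl _ ->] : bei_gens`_i \in bei_gens by exact: mem_nth.
by rewrite rmorphM rmorphB !rmorphM /= !mevalXU !mul0r subrr mulr0.
Qed.

HB.instance Definition _ := isIdealr.Build _ bei (ideal_gen_closed bei_proper).

End BinomialEdgeIdeal.

Definition binomial_edge_ideal (K : fieldType) (n : nat) (G : sgraph n) :
  idealr {mpoly K[#|vset G| + #|vset G|]} := @bei K n G.

Notation "''J_' ( K , G )" := (@binomial_edge_ideal K _ G)
  (at level 8, format "''J_' ( K ,  G )") : ring_scope.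

(* Main.v *)
Require Import Defs.
From HB Require Import structures.
From mathcomp Require Import all_boot all_order all_algebra.
From mathcomp Require Import ring_quotient boolp mpoly.
From mathcomp Require Import zify ring lra.

(* For every vertex u of a graph H, the ideal J_H is the intersection of J_(H_u),
   where the neighbourhood of u is completed to a clique, and of
   (x_u, y_u) + J_(H - u), while the sum of these two ideals is
   (x_u, y_u) + J_(H_u - u).  Hence
     Hilb(H) = Hilb(H_u) + Hilb(H - u) - Hilb(H_u - u).
   Applied at a vertex u other than v, this is compatible with the decomposition at
   v, keeps v free on both sides and is linear in both members of the identity to be
   proved; this reduces everything to graphs in which all vertices but v are free.
   One more application at v leaves disjoint unions of cliques, whose ideals are
   toric and whose Hilbert series is the product over the cliques C of
   ((1 - t) + #|C| t) / (1 - t)^(#|C| + 1).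

   The same recursion shows that Hilb is rational, and that some chain of primes
   (kernels of specialized toric parametrizations) is as long as the growth of Hilb
   allows.  Conversely a chain of l + 1 primes containing J_H provides l elements
   that are algebraically independent modulo the smallest one, so that Hilb grows at
   least with exponent l.  The Krull dimension is therefore the order of the pole of
   Hilb at t = 1, and the statements on dim and e are read off the identity. *)

Set Implicit Arguments.
Unset Strict Implicit.
Unset Printing Implicit Defensive.

Import GRing.Theory Num.Theory Order.TTheory.
Local Open Scope ring_scope.

(** All ideals of the recursion live in the one ring on all n vertices: deleting a vertex adds its
    two variables to the ideal, and Hilbert functions are dimensions relative to a subspace. No ring
    changes inside the induction; quotient rings appear only at the end. The intersection formula
    needs no primary decomposition. The retraction [kill u], setting x_u and y_u to zero, splits p
    into [p - kill u p] and [kill u p], and each piece is absorbed by one of the ideals. The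
    recursion is withheld from v until the end because completing the neighbourhood of v joins the
    two sides. All neighbours of another vertex u lie on the side of u, so the factor of the
    opposite side stays fixed; this is where linearity comes from. Primes in a chain need not be
    homogeneous, so elements are counted by bounded degree, that is, by partial sums of the Hilbert
    function. Partial sums raise the pole order by one, and a pole of order d + 1 means growth k^d;
    hence d itself is the exponent on both sides of the comparison. *)

(** * Dimension of a subspace modulo another one *)

Section RelativeDimension.
Variables (K : fieldType) (V : lmodType K).
Implicit Types U W : V -> Prop.

Definition subspace W := W 0 /\ forall a u v, W u -> W v -> W (a *: u + v).

Definition free_mod W d (b : 'I_d -> V) :=
  forall c : 'I_d -> K, W (\sum_i c i *: b i) -> forall i, c i = 0.

Definition span_mod W d (b : 'I_d -> V) (u : V) :=
  exists c : 'I_d -> K, W (u - \sum_i c i *: b i).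

(* [d] is the dimension of [(U + W) / W]. *)
Definition qdim U W d := exists b : 'I_d -> V,
  [/\ forall i, U (b i), free_mod W b & forall u, U u -> span_mod W b u].

Section Subspace.
Variables (W : V -> Prop) (sW : subspace W).

Lemma subspace0 : W 0. Proof. exact: sW.1. Qed.

Lemma subspaceZ a u : W u -> W (a *: u).
Proof. by move=> Wu; rewrite -[_ *: _]addr0; apply: sW.2 => //; exact: sW.1. Qed.

Lemma subspaceD u v : W u -> W v -> W (u + v).
Proof. by move=> Wu Wv; rewrite -[u]scale1r; apply: sW.2. Qed.

Lemma subspaceN u : W u -> W (- u).
Proof. by rewrite -scaleN1r; exact: subspaceZ. Qed.

Lemma subspaceB u v : W u -> W v -> W (u - v).
Proof. by move=> Wu /subspaceN; exact: subspaceD. Qed.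

Lemma subspace_sum (I : Type) (r : seq I) (P : pred I) (F : I -> V) :
  (forall i, P i -> W (F i)) -> W (\sum_(i <- r | P i) F i).
Proof. by move=> WF; elim/big_ind: _ => //; [exact: sW.1|exact: subspaceD]. Qed.

(** If s > d, the matrix expressing the u_i through the b_j has a nonzero left kernel vector, and
    the corresponding combination of the u_i lies in W. *)
Lemma steinitz s d (u : 'I_s -> V) (b : 'I_d -> V) :
  free_mod W u -> (forall i, span_mod W b (u i)) -> (s <= d)%N.
Proof.
move=> uf /choice[c cP]; rewrite leqNgt; apply/negP => lt_ds.
pose M := \matrix_(i < s, j < d) c i j.
have: kermx M != 0.
  by rewrite kermx_eq0 -row_leq_rank -ltnNge (leq_ltn_trans (rank_leq_col M)).
case/rowV0Pn=> a /sub_kermxP aM /eqP; apply; apply/rowP => i; rewrite mxE.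
apply: (uf (fun i => a 0 i)).
have -> : \sum_i a 0 i *: u i = \sum_i a 0 i *: (u i - \sum_j c i j *: b j).
  have: \sum_i a 0 i *: \sum_j c i j *: b j = 0.
    under eq_bigr do rewrite scaler_sumr.
    rewrite exchange_big big1 //= => j _.
    under eq_bigr do rewrite scalerA.
    rewrite -scaler_suml; move/rowP/(_ j): aM; rewrite !mxE.
    by under eq_bigr do rewrite mxE; move=> ->; rewrite scale0r.
  by move=> e; under [RHS]eq_bigr do rewrite scalerBr; rewrite sumrB e subr0.
by apply: subspace_sum => k _; apply: subspaceZ; exact: cP.
Qed.

Lemma qdim_uniq U d e : qdim U W d -> qdim U W e -> d = e.
Proof.
move=> [b [Ub fb sb]] [b' [Ub' fb' sb']]; apply/eqP; rewrite eqn_leq.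
by rewrite (steinitz fb (fun i => sb' _ (Ub i))) (steinitz fb' (fun i => sb _ (Ub' i))).
Qed.

Lemma free_mod_extend d (b : 'I_d -> V) (u : V) :
  free_mod W b -> ~ span_mod W b u ->
  free_mod W (fun i : 'I_d.+1 => oapp b u (unlift ord_max i)).
Proof.
move=> fb nsp c; rewrite (bigD1_ord ord_max) //= unlift_none /=.
under eq_bigr do rewrite liftK /=.
have [cm|c0] := eqVneq (c ord_max) 0.
  rewrite cm scale0r add0r => /(fb (c \o lift ord_max)) cl i.
  by case: (unliftP ord_max i) => [j ->|->]; [exact: cl|].
move=> Wc; case: nsp; exists (fun i => - (c ord_max)^-1 * c (lift ord_max i)).
have -> : u - \sum_i (- (c ord_max)^-1 * c (lift ord_max i)) *: b i =
    (c ord_max)^-1 *: (c ord_max *: u + \sum_i c (lift ord_max i) *: b i).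
  rewrite scalerDr scalerA mulVf // scale1r scaler_sumr -sumrN.
  by congr (_ + _); apply: eq_bigr => i _; rewrite scalerA mulNr scaleNr opprK.
exact: subspaceZ.
Qed.

(** The family b need not lie in U: a free family in U of maximal size, which exists because
    [steinitz] bounds the sizes by d, spans U modulo W. *)
Lemma qdim_of_span U d (b : 'I_d -> V) : (forall u, U u -> span_mod W b u) ->
  exists2 e, qdim U W e & (e <= d)%N.
Proof.
move=> sb.
pose P e := `[< exists b' : 'I_e -> V, (forall i, U (b' i)) /\ free_mod W b' >].
have P0 : P 0%N by apply/asboolP; exists (fun i => b (widen_ord (leq0n d) i)); split=> [|c _] [].
have Pd e : P e -> (e <= d)%N.
  by move=> /asboolP[b' [Ub' /steinitz]]; apply => i; exact/sb.
have exP : exists e, P e by exists 0%N.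
case: (ex_maxnP exP Pd) => e Pe eM; exists e; last exact: Pd.
move/asboolP: (Pe) => [b' [Ub' fb']]; exists b'; split=> // u Uu.
apply: contrapT => /(free_mod_extend fb') fbu.
suff /eM : P e.+1 by rewrite ltnn.
apply/asboolP; eexists; split; last exact: fbu.
by move=> i /=; case: unliftP => [j|] _ /=.
Qed.

End Subspace.

Lemma qdim_ext U U' W W' d : (forall u, U u <-> U' u) -> (forall u, W u <-> W' u) ->
  qdim U W d -> qdim U' W' d.
Proof.
move=> eU eW [b [Ub fb sb]]; exists b; split=> [i|c /eW /fb //|u /eU /sb[c Wc]].
  exact/eU.
by exists c; apply/eW.
Qed.

(** A basis of the part of U inside W', modulo W, followed by a basis of U modulo W', is a basis of
    U modulo W. *)
Lemma qdim_add U W W' d e : subspace W -> subspace W' -> (forall u, W u -> W' u) ->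
  qdim (fun u => U u /\ W' u) W d -> qdim U W' e -> subspace U ->
  qdim U W (d + e).
Proof.
move=> sW sW' sWW' [b [Ub fb sb]] [b' [Ub' fb' sb']] sU.
pose B (i : 'I_(d + e)) := match split i with inl j => b j | inr j => b' j end.
have BE (c : 'I_(d + e) -> K) :
    \sum_i c i *: B i = \sum_i c (lshift e i) *: b i + \sum_i c (rshift d i) *: b' i.
  rewrite big_split_ord; congr (_ + _); apply: eq_bigr => i _; rewrite /B.
    by rewrite (unsplitK (inl i)).
  by rewrite (unsplitK (inr i)).
exists B; split=> [i|c|u Uu].
- by rewrite /B; case: split => j //; case: (Ub j).
- rewrite BE => Wc.
  have W'b : W' (\sum_i c (lshift e i) *: b i).
    by apply: subspace_sum => // i _; apply: subspaceZ => //; case: (Ub i).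
  have c2 : forall i, c (rshift d i) = 0.
    apply: (fb' (fun i => c (rshift d i))).
    rewrite -[X in W' X](addKr (\sum_i c (lshift e i) *: b i)) addrC.
    by apply: subspaceB => //; exact: sWW'.
  have c1 : forall i, c (lshift e i) = 0.
    apply: (fb (fun i => c (lshift e i))); move: Wc.
    by rewrite [X in _ + X]big1 ?addr0 // => i _; rewrite c2 scale0r.
  by move=> i; rewrite -(splitK i); case: split => j /=.
- have [c' W'c] := sb' u Uu.
  have [|c Wc] := sb (u - \sum_i c' i *: b' i).
    split=> //; apply: (subspaceB sU) => //.
    by apply: (subspace_sum sU) => i _; exact: subspaceZ.
  exists (fun i => match split i with inl j => c j | inr j => c' j end).
  rewrite BE opprD addrA addrAC; move: Wc; congr (W (_ - _ - _)).
    by apply: eq_bigr => i _; rewrite (unsplitK (inr i)).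
  by apply: eq_bigr => i _; rewrite (unsplitK (inl i)).
Qed.

(** Second isomorphism theorem inside U: the same family is a basis on both sides. *)
Lemma qdim_second_iso U W1 W2 W W3 d :
  (forall u, W u <-> W1 u /\ W2 u) -> subspace W1 -> subspace W2 -> subspace U ->
  (forall u, U u -> W3 u -> exists2 u2, U u2 /\ W2 u2 & W1 (u - u2)) ->
  (forall u, W1 u -> W3 u) -> (forall u, W2 u -> W3 u) -> subspace W3 ->
  qdim (fun u => U u /\ W2 u) W d -> qdim (fun u => U u /\ W3 u) W1 d.
Proof.
move=> WE sW1 sW2 sU split3 sW13 sW23 sW3 [b [Ub fb sb]]; exists b; split.
- by move=> i; have [? ?] := Ub i; split=> //; exact: sW23.
- move=> c W1c; apply: fb; apply/WE; split=> //.
  by apply: subspace_sum => // i _; apply: subspaceZ => //; have [] := Ub i.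
- move=> u [Uu W3u]; have [u2 Uu2 W1u] := split3 _ Uu W3u.
  have [c /WE[W1c _]] := sb _ Uu2; exists c.
  by rewrite -(subrK u2 u) -addrA; exact: subspaceD.
Qed.

(* [W] is the intersection of [W1] and [W2], and [W3] their sum; the splitting of
   [W3] is only required on [U]. *)
Lemma qdim_inter_sum U W1 W2 W W3 d d1 d2 d3 :
  (forall u, W u <-> W1 u /\ W2 u) ->
  (forall u, U u -> W3 u -> exists2 u2, U u2 /\ W2 u2 & W1 (u - u2)) ->
  (forall u, W1 u -> W3 u) -> (forall u, W2 u -> W3 u) ->
  subspace U -> subspace W -> subspace W1 -> subspace W2 -> subspace W3 ->
  qdim U W d -> qdim U W1 d1 -> qdim U W2 d2 -> qdim U W3 d3 ->
  (d + d3 = d1 + d2)%N.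
Proof.
move=> WE split3 sW13 sW23 sU sW sW1 sW2 sW3 q q1 q2 q3.
have [b [_ _ sb]] := q.
have [|e qe _] := qdim_of_span (b := b) sW (U := fun u => U u /\ W2 u).
  by move=> u [/sb].
have sWW2 u : W u -> W2 u by move/WE => [].
have e1 := qdim_uniq sW q (qdim_add sW sW2 sWW2 qe q2 sU).
have qe' := qdim_second_iso WE sW1 sW2 sU split3 sW13 sW23 sW3 qe.
have e2 := qdim_uniq sW1 q1 (qdim_add sW1 sW3 sW13 qe' q3 sU).
lia.
Qed.

Lemma qdim_seq (T : eqType) (s : seq T) (f : T -> V) U W :
  uniq s -> (forall x, x \in s -> U (f x)) ->
  (forall c : T -> K, W (\sum_(x <- s) c x *: f x) -> forall x, x \in s -> c x = 0) ->
  (forall u, U u -> exists c : T -> K, W (u - \sum_(x <- s) c x *: f x)) ->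
  qdim U W (size s).
Proof.
move=> us Uf ff sf; exists (fun i => f (tnth (in_tuple s) i)); split.
- by move=> i; apply: Uf; exact: mem_tnth.
- move=> c Wc i.
  pose c' x := odflt 0 (omap c (insub (index x s))).
  have c'E j : c' (tnth (in_tuple s) j) = c j.
    have sj : (index (tnth (in_tuple s) j) s < size s)%N by rewrite index_mem mem_tnth.
    rewrite /c' insubT /=; congr c; apply: val_inj => /=.
    by rewrite (tnth_nth (tnth (in_tuple s) j)) index_uniq.
  rewrite -c'E; apply: (ff c'); last exact: mem_tnth.
  by rewrite big_tnth; under eq_bigr do rewrite c'E.
- move=> u /sf[c Wc]; exists (fun i => c (tnth (in_tuple s) i)).
  by move: Wc; rewrite big_tnth.
Qed.

End RelativeDimension.

(** * Binomial edge ideals and deletion of vertices *)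

Section GeneratedIdeal.
Variable R : comNzRingType.
Implicit Types (g : R -> Prop) (a p q : R).

(** An inductive predicate, so that facts about ideals follow by induction on the number of terms,
    without families of coefficients. *)
Inductive gideal g : R -> Prop :=
| gideal0 : gideal g 0
| gideal_step a p q : g p -> gideal g q -> gideal g (a * p + q).

Lemma gideal_gen g p : g p -> gideal g p.
Proof. by move=> gp; rewrite -[p]mul1r -[_ * _]addr0; do !constructor. Qed.

Lemma gidealD g p q : gideal g p -> gideal g q -> gideal g (p + q).
Proof.
move=> gp gq; elim: gp => [|a r s gr _ IH]; first by rewrite add0r.
by rewrite -addrA; constructor.
Qed.

Lemma gidealM g a p : gideal g p -> gideal g (a * p).
Proof.
elim=> [|b q r gq _ IH]; first by rewrite mulr0; constructor.
by rewrite mulrDr mulrA; constructor.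
Qed.

Lemma gidealMr g a p : gideal g p -> gideal g (p * a).
Proof. by rewrite mulrC; exact: gidealM. Qed.

Lemma gidealB g p q : gideal g p -> gideal g q -> gideal g (p - q).
Proof. by move=> gp gq; apply: gidealD => //; rewrite -mulN1r; exact: gidealM. Qed.

Lemma gideal_sum g (I : Type) (r : seq I) (P : pred I) (F : I -> R) :
  (forall i, P i -> gideal g (F i)) -> gideal g (\sum_(i <- r | P i) F i).
Proof. by move=> gF; elim/big_ind: _ => //; [exact: gideal0|exact: gidealD]. Qed.

End GeneratedIdeal.

Lemma gideal_morph (R R' : comNzRingType) (f : {rmorphism R -> R'}) g g' p :
  (forall q, g q -> gideal g' (f q)) -> gideal g p -> gideal g' (f p).
Proof.
move=> gf; elim=> [|a q r gq _ IH]; first by rewrite rmorph0; constructor.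
by rewrite rmorphD rmorphM; apply: gidealD => //; apply: gidealM; exact: gf.
Qed.

Lemma gideal_sub (R : comNzRingType) (g g' : R -> Prop) p :
  (forall q, g q -> gideal g' q) -> gideal g p -> gideal g' p.
Proof. exact: (@gideal_morph _ _ idfun). Qed.

Lemma gideal_subspace (K : fieldType) m (g : {mpoly K[m]} -> Prop) : subspace (gideal g).
Proof.
split=> [|a u v gu gv]; first exact: gideal0.
by apply: gidealD => //; rewrite -mul_mpolyC; exact: gidealM.
Qed.

Section Substitution.
Variables (K : fieldType) (m N : nat).
Implicit Types h : 'I_m -> {mpoly K[N]}.

Definition subst h : {mpoly K[m]} -> {mpoly K[N]} := mmap (@mpolyC N K) h.

HB.instance Definition _ h := GRing.RMorphism.on (subst h).

Lemma substX h i : subst h 'X_i = h i.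
Proof. by rewrite /subst mmapX mmap1U. Qed.

Lemma substZ h a p : subst h (a *: p) = a *: subst h p.
Proof. by rewrite /subst mmapZ mul_mpolyC. Qed.

Lemma subst_homog h k p : (forall i, h i \is 1.-homog) ->
  p \is k.-homog -> subst h p \is k.-homog.
Proof.
move=> hh /dhomogP hp; rewrite /subst /mmap big_seq; apply: rpred_sum => mm mp.
rewrite mul_mpolyC; apply: rpredZ; rewrite -(hp _ mp) /= mdegE /mmap1.
elim/big_rec2: _ => [|i d q _ qd]; first exact: dhomog1.
by apply: dhomogM => //; rewrite -[X in X.-homog]mul1n; apply: dhomogMn.
Qed.

End Substitution.

Lemma subst_comp (K : fieldType) m N M (h : 'I_m -> {mpoly K[N]})
    (h' : 'I_N -> {mpoly K[M]}) p :
  subst h' (subst h p) = subst (subst h' \o h) p.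
Proof.
rewrite [subst h p]/subst /mmap raddf_sum /=; apply: eq_bigr => mm _.
rewrite (rmorphM (subst h')) /=; congr (_ * _); first by rewrite /subst mmapC.
by rewrite /mmap1 rmorph_prod; apply: eq_bigr => i _; rewrite rmorphXn.
Qed.

Lemma eq_subst (K : fieldType) m N (h h' : 'I_m -> {mpoly K[N]}) p :
  h =1 h' -> subst h p = subst h' p.
Proof.
move=> hh; rewrite /subst /mmap; apply: eq_bigr => mm _; congr (_ * _).
by apply: eq_bigr => i _; rewrite hh.
Qed.

(** By linearity it suffices to telescope the difference of two products. Both uses compare the
    identity with a substitution that moves each variable by an element of the ideal. *)
Lemma subst_cong (K : fieldType) m N (h h' : 'I_m -> {mpoly K[N]}) (g : _ -> Prop) p :
  (forall i, gideal g (h i - h' i)) -> gideal g (subst h p - subst h' p).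
Proof.
move=> hh; elim/mpolyind: p => [|a mm p _ _ IH]; first by rewrite !rmorph0 subrr; exact: gideal0.
rewrite !rmorphD /= opprD addrACA; apply: gidealD => //.
rewrite !substZ -scalerBr -mul_mpolyC; apply: gidealM.
rewrite /subst !mmapX /mmap1.
apply: (big_ind2 (fun x y => gideal g (x - y))) => [|x1 x2 y1 y2 gx gy|i _] /=.
- by rewrite subrr; exact: gideal0.
- have E : x1 * y1 - x2 * y2 = (x1 - x2) * y1 + x2 * (y1 - y2) by ring.
  rewrite [X in gideal _ X]E.
  by apply: gidealD; [exact: gidealMr|exact: gidealM].
- by rewrite subrXX; apply: gidealMr; exact: hh.
Qed.

Lemma subst_id (K : fieldType) m (p : {mpoly K[m]}) : subst (fun i => 'X_i) p = p.
Proof.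
rewrite [RHS](mpolyE p) /subst /mmap; apply: eq_bigr => mm _.
by rewrite mul_mpolyC mpolyXE_id.
Qed.

(** * Hilbert functions as relative dimensions *)

Section HilbertFunction.
Variables (K : fieldType) (m : nat).
Implicit Types W : {mpoly K[m]} -> Prop.

Definition degpart k (p : {mpoly K[m]}) : Prop := p \is k.-homog.

Lemma degpart_subspace k : subspace (degpart k).
Proof. by split=> [|a u v hu hv]; [exact: dhomog0|exact/rpredD/hv/dhomogZ]. Qed.

Lemma degpart_qdim W k : subspace W -> exists d, qdim (degpart k) W d.
Proof.
move=> sW; pose T := [pred t : 'X_{1..m < k.+1} | mdeg t == k].
have [|d qd _] := qdim_of_span (b := fun i : 'I_#|T| => 'X_[bmnm (enum_val i)])
  sW (U := degpart k); last by exists d.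
move=> p p_hom; exists (fun i => p@_(bmnm (enum_val i))).
rewrite -(@big_enum_val _ _ _ _ T (fun t => p@_(bmnm t) *: 'X_[bmnm t])).
rewrite -[X in X - _](pihomog_dE p_hom) (pihomogwE mdeg k (k := k.+1)); last first.
  rewrite mmeasureE; apply/bigmax_leqP_seq => t tp _.
  by rewrite (dhomog_mf p_hom).
by rewrite subrr; exact: subspace0.
Qed.

Definition hilb W k : nat :=
  if pselect (exists d, qdim (degpart k) W d) is left e then projT1 (cid e) else 0%N.

Lemma hilbP W k : subspace W -> qdim (degpart k) W (hilb W k).
Proof.
move=> sW; rewrite /hilb; case: pselect => [e|/(_ (degpart_qdim k sW))//].
exact: projT2 (cid e).
Qed.

Lemma hilb_eq W k d : subspace W -> qdim (degpart k) W d -> hilb W k = d.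
Proof. by move=> sW; exact/(qdim_uniq sW)/hilbP. Qed.

Lemma hilb_ext W W' k : subspace W -> (forall p, W p <-> W' p) -> hilb W k = hilb W' k.
Proof.
move=> sW eW; apply: hilb_eq => //.
have sW' : subspace W'.
  by case: sW => W0 WD; split=> [|a u v]; rewrite -!eW //; exact: WD.
by apply: qdim_ext (hilbP k sW') => // p; rewrite eW.
Qed.

End HilbertFunction.

Section EdgeIdeal.
Variables (K : fieldType) (n : nat).
Local Notation S := {mpoly K[n + n]}.
Implicit Types (e : rel 'I_n) (U : {set 'I_n}) (u : 'I_n).

Definition xv (i : 'I_n) : S := 'X_(lshift n i).
Definition yv (i : 'I_n) : S := 'X_(rshift n i).

Definition vert (i : 'I_(n + n)) : 'I_n :=
  match split i with inl j => j | inr j => j end.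

Lemma vert_lshift i : vert (lshift n i) = i.
Proof. by rewrite /vert (unsplitK (inl i)). Qed.

Lemma vert_rshift i : vert (rshift n i) = i.
Proof. by rewrite /vert (unsplitK (inr i)). Qed.

Definition edge_poly i j : S := xv i * yv j - xv j * yv i.

(* Generators of [J_e + (x_u, y_u : u \in U)]: the vertices of [U] are deleted
   without changing the ambient ring. *)
Inductive egen e U : S -> Prop :=
| egen_edge i j : e i j -> egen e U (edge_poly i j)
| egen_x u : u \in U -> egen e U (xv u)
| egen_y u : u \in U -> egen e U (yv u).

Definition J e U := gideal (egen e U).

Lemma J_subspace e U : subspace (J e U).
Proof. exact: gideal_subspace. Qed.

Definition saturate e u : rel 'I_n := fun i j => e i j || [&& i != j, e u i & e u j].

(** The retraction onto the polynomials free of x_u and y_u; its kernel is the ideal (x_u, y_u). *)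
Definition kill u : S -> S := subst (fun i => if vert i == u then 0 else 'X_i).

HB.instance Definition _ u := GRing.RMorphism.on (kill u).

Lemma kill_xv u i : kill u (xv i) = if i == u then 0 else xv i.
Proof. by rewrite /kill substX vert_lshift. Qed.

Lemma kill_yv u i : kill u (yv i) = if i == u then 0 else yv i.
Proof. by rewrite /kill substX vert_rshift. Qed.

Lemma kill_edge u i j : kill u (edge_poly i j) =
  if (i == u) || (j == u) then 0 else edge_poly i j.
Proof.
rewrite /edge_poly rmorphB !rmorphM /= !kill_xv !kill_yv.
by case: eqP => _; case: eqP => _ /=; rewrite ?(mulr0, mul0r) ?subrr.
Qed.

Lemma kill_homog u k p : degpart k p -> degpart k (kill u p).
Proof.
apply: subst_homog => i; case: ifP => _; first exact: dhomog0.
by rewrite dhomogX /= mdeg1.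
Qed.

Lemma kill_cong (g : S -> Prop) u p : gideal g (xv u) -> gideal g (yv u) ->
  gideal g (p - kill u p).
Proof.
move=> gx gy; rewrite -[X in X - _](subst_id p); apply: subst_cong => i.
rewrite /vert; case: (split i) (splitK i) => j <- /=; case: eqP => [->|_];
  by rewrite ?subr0 ?subrr //; exact: gideal0.
Qed.

Lemma J_kill e e' U u p :
  (forall i j, e i j -> i != u -> j != u -> J e' U (edge_poly i j)) ->
  J e (u |: U) p -> J e' U (kill u p).
Proof.
move=> ee'; apply: gideal_morph => q [i j eij|w|w].
- rewrite /= kill_edge; case: ifPn => [_|]; first exact: gideal0.
  by rewrite negb_or => /andP[iu ju]; exact: ee'.
- rewrite /= kill_xv in_setU1; case: eqP => //= [_ _|_ wU]; first exact: gideal0.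
  exact/gideal_gen/egen_x.
- rewrite /= kill_yv in_setU1; case: eqP => //= [_ _|_ wU]; first exact: gideal0.
  exact/gideal_gen/egen_y.
Qed.

Lemma J_mono e e' U U' p : (forall i j, e i j -> J e' U' (edge_poly i j)) ->
  U \subset U' -> J e U p -> J e' U' p.
Proof.
move=> ee' /subsetP sU; apply: gideal_sub => q [i j /ee' //|u uU|u uU].
  exact/gideal_gen/egen_x/sU.
exact/gideal_gen/egen_y/sU.
Qed.

Lemma J_edge e U i j : e i j -> J e U (edge_poly i j).
Proof. by move=> eij; exact/gideal_gen/egen_edge. Qed.

Section Ohtani.
Variables (e : rel 'I_n) (U : {set 'I_n}) (u : 'I_n).

(* The new generators [f_ij] of [J (saturate e u) U] are multiplied into [J e U] by
   [x_u] and [y_u], and [p - kill u p] only involves multiples of these variables. *)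
Lemma saturate_kill p : J (saturate e u) U p -> J e U (p - kill u p).
Proof.
elim=> [|a q r gq Jr IH]; first by rewrite rmorph0 subrr; exact: gideal0.
rewrite rmorphD rmorphM /= opprD addrACA; apply: gidealD => //.
have old : J e U q -> J e U (kill u q) -> J e U (a * q - kill u a * kill u q).
  by move=> Jq Jkq; apply: gidealB; exact: gidealM.
case: gq old => [i j sij|w wU|w wU] old.
- case/orP: sij => [eij|/and3P[_ eui euj]].
    apply: old; first exact: J_edge.
    by rewrite kill_edge; case: ifP => _; [exact: gideal0|exact: J_edge].
  have Jx : J e U (xv u * edge_poly i j).
    have -> : xv u * edge_poly i j = xv i * edge_poly u j - xv j * edge_poly u i.
      by rewrite /edge_poly; ring.
    by apply: gidealB; apply: gidealM; exact: J_edge.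
  have Jy : J e U (yv u * edge_poly i j).
    have -> : yv u * edge_poly i j = yv i * edge_poly u j - yv j * edge_poly u i.
      by rewrite /edge_poly; ring.
    by apply: gidealB; apply: gidealM; exact: J_edge.
  rewrite kill_edge; case: ifPn => [/orP ijs|_].
    have -> : a * edge_poly i j - kill u a * 0 = a * edge_poly i j by ring.
    apply: gidealM; case: ijs => /eqP E; subst.
      exact: J_edge.
    have -> : edge_poly i u = - 1 * edge_poly u i by rewrite /edge_poly; ring.
    by apply: gidealM; exact: J_edge.
  rewrite -mulrBl.
  have: gideal (fun q => q = xv u \/ q = yv u) (a - kill u a).
    by apply: kill_cong; apply: gideal_gen; [left|right].
  elim=> [|b s t gs _ IHt]; first by rewrite mul0r; exact: gideal0.
  rewrite mulrDl -mulrA; apply: gidealD => //; apply: gidealM.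
  by case: gs => ->.
- apply: old; first exact/gideal_gen/egen_x.
  by rewrite kill_xv; case: eqP => _; [exact: gideal0|exact/gideal_gen/egen_x].
- apply: old; first exact/gideal_gen/egen_y.
  by rewrite kill_yv; case: eqP => _; [exact: gideal0|exact/gideal_gen/egen_y].
Qed.

(** For the converse, p is the sum of [p - kill u p], which [saturate_kill] puts in [J e U], and of
    [kill u p], which is there because [kill u] sends x_u and y_u to 0 and every other generator to
    itself or 0. *)
Lemma ohtani_inter p : J e U p <-> J (saturate e u) U p /\ J e (u |: U) p.
Proof.
split=> [Jp|[Jsp Jkp]].
  split; apply: J_mono Jp => //; last exact: subsetUr.
    by move=> i j eij; apply: J_edge; rewrite /saturate eij.
  by move=> i j; exact: J_edge.
rewrite -(subrK (kill u p) p); apply: gidealD; first exact: saturate_kill.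
by apply: J_kill Jkp => i j eij _ _; exact: J_edge.
Qed.

(** The sum of the two ideals is [J (saturate e u) (u |: U)]: for p in it, [p - kill u p] lies in
    (x_u, y_u) and [kill u p] in [J (saturate e u) U]. As [kill u] preserves degrees, the splitting
    exists in each degree. *)
Lemma hilb_ohtani k : (hilb (J e U) k + hilb (J (saturate e u) (u |: U)) k =
  hilb (J (saturate e u) U) k + hilb (J e (u |: U)) k)%N.
Proof.
apply: (qdim_inter_sum (K := K) (U := degpart k) (W1 := J (saturate e u) U)
  (W2 := J e (u |: U)) (W := J e U) (W3 := J (saturate e u) (u |: U)));
  try exact: J_subspace; try exact/hilbP/J_subspace.
- exact: ohtani_inter.
- move=> p hp Jp; exists (p - kill u p).
    split; last by apply: kill_cong; apply: gideal_gen; constructor; rewrite setU11.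
    by apply: (subspaceB (degpart_subspace _ _ _)) => //; exact: kill_homog.
  rewrite subKr; apply: J_kill Jp => i j eij _ _; exact: J_edge.
- by move=> p; apply: J_mono; [move=> i j; exact: J_edge|exact: subsetUr].
- by move=> p; apply: J_mono => // i j eij; apply: J_edge; rewrite /saturate eij.
- exact: degpart_subspace.
Qed.

End Ohtani.

End EdgeIdeal.

(** * The ring of formal power series *)

(* A copy of [fps] carrying the ring structure whose product is [fps_mul]. *)
Definition fser : Type := fps.

Section SeriesRing.
Implicit Types f g h : fser.

Definition fser_add f g : fser := fun k => f k + g k.
Definition fser_opp f : fser := fun k => - f k.
Definition fser_mul f g : fser := fps_mul f g.
Definition fser_one : fser := fps_of_poly 1.

(** A coefficient of a product sees only truncations of the factors, so commutativity, associativity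
    and the unit law are inherited from polynomials. *)
Lemma fser_mulE k f g : fser_mul f g k = (\poly_(i < k.+1) f i * \poly_(i < k.+1) g i)`_k.
Proof.
rewrite coefM; apply: eq_bigr => i _; rewrite !coef_poly !ltnS leq_subr.
by rewrite -ltnS ltn_ord.
Qed.

Lemma fser_mul_coef f g (p q : {poly int}) k :
  (forall i, (i <= k)%N -> f i = p`_i) -> (forall i, (i <= k)%N -> g i = q`_i) ->
  fser_mul f g k = (p * q)`_k.
Proof.
move=> fp gq; rewrite coefM; apply: eq_bigr => i _.
by rewrite fp ?gq ?leq_subr // -ltnS.
Qed.

Fact fser_addA : associative fser_add.
Proof. by move=> f g h; apply/funext => k; exact: addrA. Qed.
Fact fser_addC : commutative fser_add.
Proof. by move=> f g; apply/funext => k; exact: addrC. Qed.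
Fact fser_add0 : left_id (fun=> 0) fser_add.
Proof. by move=> f; apply/funext => k; exact: add0r. Qed.
Fact fser_addN : left_inverse (fun=> 0) fser_opp fser_add.
Proof. by move=> f; apply/funext => k; exact: addNr. Qed.

Fact fser_mulC : commutative fser_mul.
Proof. by move=> f g; apply/funext => k; rewrite !fser_mulE mulrC. Qed.

Fact fser_mulA : associative fser_mul.
Proof.
move=> f g h; apply/funext => k.
pose T (f : fser) := \poly_(i < k.+1) f i.
have TE (f' : fser) i : (i <= k)%N -> f' i = (T f')`_i by rewrite coef_poly ltnS => ->.
have TM f' g' i : (i <= k)%N -> fser_mul f' g' i = (T f' * T g')`_i.
  by move=> ik; apply: fser_mul_coef => j ji; rewrite -TE ?(leq_trans ji).
by rewrite (fser_mul_coef (TE f) (TM g h)) (fser_mul_coef (TM f g) (TE h)) mulrA.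
Qed.

Fact fser_mul1 : left_id fser_one fser_mul.
Proof.
move=> f; apply/funext => k.
rewrite (@fser_mul_coef _ _ 1 (\poly_(i < k.+1) f i)) // ?mul1r ?coef_poly ?ltnSn //.
by move=> i ik; rewrite coef_poly ltnS ik.
Qed.

Fact fser_mulDl : left_distributive fser_mul fser_add.
Proof.
move=> f g h; apply/funext => k.
rewrite /fser_add /fser_mul /fps_mul -big_split; apply: eq_bigr => i _.
exact: mulrDl.
Qed.

Fact fser_one_neq0 : fser_one <> (fun=> 0).
Proof. by move/(congr1 (fun f : fser => f 0)); rewrite /fser_one /fps_of_poly coef1. Qed.

End SeriesRing.

HB.instance Definition _ := gen_eqMixin fser.
HB.instance Definition _ := gen_choiceMixin fser.
HB.instance Definition _ := GRing.isZmodule.Build fser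
  fser_addA fser_addC fser_add0 fser_addN.
Fact fser_oner_neq0 : fser_one != 0. Proof. exact/eqP/fser_one_neq0. Qed.
HB.instance Definition _ := GRing.Zmodule_isComNzRing.Build fser
  fser_mulA fser_mulC fser_mul1 fser_mulDl fser_oner_neq0.

Section SeriesTheory.
Implicit Types (f g : fser) (p q : {poly int}).

Definition toser p : fser := fps_of_poly p.

Lemma fserD f g k : (f + g) k = f k + g k. Proof. by []. Qed.
Lemma fserN f k : (- f) k = - f k. Proof. by []. Qed.
Lemma fserB f g k : (f - g) k = f k - g k. Proof. by []. Qed.
Lemma fserM f g k : (f * g) k = \sum_(i < k.+1) f i * g (k - i)%N. Proof. by []. Qed.

Fact toser_zmod_morphism : zmod_morphism toser.
Proof. by move=> p q; apply/funext => k; exact: coefB. Qed.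
Fact toser_monoid_morphism : monoid_morphism toser.
Proof. by split=> // p q; apply/funext => k; exact: coefM. Qed.

HB.instance Definition _ := GRing.isZmodMorphism.Build _ _ toser toser_zmod_morphism.
HB.instance Definition _ := GRing.isMonoidMorphism.Build _ _ toser toser_monoid_morphism.

Lemma toser_inj : injective toser.
Proof.
move=> p q /(congr1 (fun f : fser => f : nat -> int)) e; apply/polyP => k.
by rewrite [LHS](congr1 (fun f => f k) e).
Qed.

Lemma toserC (a : int) : toser a%:P = a%:~R.
Proof. by rewrite -[a in LHS]intz !rmorph_int. Qed.

Lemma intr_coef (a : int) f k : (a%:~R * f) k = a * f k.
Proof.
rewrite -toserC fserM big_ord_recl big1 ?addr0 ?subn0 /toser /fps_of_poly ?coefC //= => i _.
by rewrite coefC mul0r.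
Qed.

(** The inverse of 1 - t; multiplication by it takes partial sums of coefficients. *)
Definition geo : fser := fun=> 1.

Local Notation t := (toser 'X).

Lemma geo_coef f k : (geo * f) k = \sum_(i < k.+1) f i.
Proof.
rewrite fserM (reindex_inj rev_ord_inj) /=; apply: eq_bigr => i _.
by rewrite mul1r subSS subKn // -ltnS.
Qed.

Lemma t_coef0 f : (t * f) 0%N = 0.
Proof. by rewrite fserM big_ord1 /toser /fps_of_poly coefX mul0r. Qed.

Lemma t_coefS f k : (t * f) k.+1 = f k.
Proof.
rewrite fserM (bigD1 (1 : 'I_k.+2)) //= big1 ?addr0.
  by rewrite /toser /fps_of_poly coefX mul1r subn1.
move=> i ni; rewrite /toser /fps_of_poly coefX.
by case: eqP => [i1|]; rewrite ?mul0r //; case/eqP: ni; apply: val_inj; rewrite /= i1.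
Qed.

Lemma geoV : (1 - t) * geo = 1.
Proof.
apply/funext => -[|k]; rewrite mulrBl mul1r fserB.
  by rewrite t_coef0 subr0 /geo [RHS]coef1.
by rewrite t_coefS subrr [RHS]coef1.
Qed.

Lemma tgeo2_coef k : (t * geo ^+ 2) k = k%:Z.
Proof.
case: k => [|k]; first by rewrite t_coef0.
rewrite t_coefS expr2 geo_coef /geo sumr_const card_ord.
by rewrite -mulr_natr mul1r natz.
Qed.

Lemma toser_s n : toser ((1 - 'X) ^+ n) = (1 - t) ^+ n.
Proof. by rewrite rmorphXn rmorphB rmorph1. Qed.

Lemma s_lreg n : GRing.lreg ((1 - t) ^+ n).
Proof.
move=> f g /(congr1 (fun h => geo ^+ n * h)).
by rewrite /= !mulrA -exprMn [geo * _]mulrC geoV expr1n !mul1r.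
Qed.

Lemma s_eq n f g : (1 - t) ^+ n * f = g -> f = geo ^+ n * g.
Proof. by move=> <-; rewrite mulrA -exprMn [geo * _]mulrC geoV expr1n mul1r. Qed.

End SeriesTheory.

Notation tser := (toser 'X).

(** * Disjoint unions of cliques *)

Section Box.
Variable q : nat.
Implicit Types b s : 'X_{1..q}.

Definition box b : seq 'X_{1..q} :=
  [seq [multinom (f j : nat) | j < q]
    | f : {ffun 'I_q -> 'I_(mdeg b).+1} in
      family (fun j => [pred i : 'I_(mdeg b).+1 | (i <= b j)%N])].

Lemma mem_box b s : (s \in box b) = [forall j, (s j <= b j)%N].
Proof.
have b_le j : (b j <= mdeg b)%N by rewrite mdegE (bigD1 j) //= leq_addr.
apply/imageP/forallP => [[f /familyP fb ->] j|sb]; first by rewrite mnmE; exact: fb.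
exists [ffun j => inord (s j)].
  by apply/familyP => j; rewrite inE ffunE inordK // ltnS (leq_trans (sb j)).
by apply/mnmP => j; rewrite mnmE ffunE inordK // ltnS (leq_trans (sb j)).
Qed.

Lemma box_uniq b : uniq (box b).
Proof.
rewrite map_inj_uniq ?enum_uniq // => f g /mnmP fg; apply/ffunP => j; apply: val_inj.
by have := fg j; rewrite !mnmE.
Qed.

Lemma size_box b : size (box b) = (\prod_j (b j).+1)%N.
Proof.
rewrite size_image card_family foldrE big_map enumT; apply: eq_bigr => j _.
rewrite -sum1_card -[RHS]card_ord -sum1_card.
rewrite (big_ord_widen (mdeg b).+1 (fun _ => 1%N)) //.
by rewrite ltnS mdegE (bigD1 j) //= leq_addr.
Qed.

End Box.

Section MonomialsOver.
Variable n : nat.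
Implicit Types (ws : seq 'I_n) (g : 'X_{1..n}).

Fixpoint monos ws k : seq 'X_{1..n} :=
  if ws is w :: ws' then [seq (g + U_(w) *+ i)%MM | i <- iota 0 k.+1, g <- monos ws' (k - i)%N]
  else if k is 0%N then [:: 0%MM] else [::].

Lemma monos_cons w ws k : monos (w :: ws) k =
  [seq (g + U_(w) *+ i)%MM | i <- iota 0 k.+1, g <- monos ws (k - i)%N].
Proof. by []. Qed.

Lemma mem_monos ws k g : uniq ws ->
  (g \in monos ws k) = (mdeg g == k) && [forall w, (w \in ws) || (g w == 0%N)].
Proof.
elim: ws k g => [|w ws IH] k g.
  move=> _; apply/idP/andP => [|[/eqP <- /forallP g0]].
    case: k => [|k] //; rewrite inE => /eqP ->; rewrite mdeg0; split=> //.
    by apply/forallP => w; rewrite mnm0E.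
  suff -> : g = 0%MM by rewrite mdeg0 mem_seq1.
  by apply/mnmP => w; rewrite mnm0E; exact/eqP/g0.
rewrite monos_cons => /andP[nw uws].
apply/allpairsPdep/andP => [[i [h [ik hm ->]]]|[/eqP gk /forallP g0]].
  move: hm; rewrite IH // => /andP[/eqP hk /forallP h0]; split.
    rewrite mdegD mdegMn mdeg1 hk mul1n subnK //.
    by move: ik; rewrite mem_iota /= add0n ltnS.
  apply/forallP => w'; rewrite inE mnmDE mulmnE mnm1E.
  have := h0 w'; rewrite [w == w']eq_sym; case: (w' =P w) => //= _.
  by rewrite mul0n addn0.
exists (g w), (g - U_(w) *+ g w)%MM; split.
- by rewrite mem_iota add0n /= ltnS -gk mdegE (bigD1 w) //= leq_addr.
- have le : (U_(w) *+ g w <= g)%MM.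
    apply/mnm_lepP => w'; rewrite mulmnE mnm1E; case: eqP => [->|_]; last by rewrite mul0n.
    by rewrite mul1n.
  rewrite IH //; apply/andP; split.
    have gE : mdeg g = (mdeg (g - U_(w) *+ g w)%MM + g w)%N.
      by rewrite -[in LHS](submK le) mdegD mdegMn mdeg1 mul1n.
    by rewrite -gk gE addnK.
  apply/forallP => w'; rewrite mnmBE mulmnE mnm1E.
  have := g0 w'; rewrite inE eq_sym; case: (w =P w') => [<- _|_ /=].
    by rewrite mul1n subnn eqxx orbT.
  by rewrite mul0n subn0.
- rewrite submK //; apply/mnm_lepP => w'; rewrite mulmnE mnm1E.
  by case: eqP => [->|_]; rewrite ?mul1n ?mul0n.
Qed.

Lemma monos_uniq ws k : uniq ws -> uniq (monos ws k).
Proof.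
elim: ws k => [|w ws IH] k; first by case: k.
rewrite monos_cons => /andP[nw uws]; apply: allpairs_uniq_dep.
- exact: iota_uniq.
- by move=> i _; exact: IH.
move=> _ _ /allpairsPdep[i [g [_ gm ->]]] /allpairsPdep[i' [g' [_ gm' ->]]] /=.
have g0 h l : h \in monos ws l -> h w = 0%N.
  by rewrite mem_monos // => /andP[_ /forallP/(_ w)]; rewrite (negPf nw) => /eqP.
move=> E; have ii : i = i'.
  have := congr1 (fun m : 'X_{1..n} => m w) E.
  by rewrite !mnmDE !mulmnE !mnm1E eqxx !mul1n (g0 _ _ gm) (g0 _ _ gm').
by move: E; rewrite ii => /addIm ->.
Qed.

End MonomialsOver.

Section ClusterSeries.
Variables (n q : nat) (c : 'I_n -> 'I_q).

Definition csum (g : 'X_{1..n}) : 'X_{1..q} := [multinom (\sum_(w | c w == j) g w)%N | j < q].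

(* Counts the pairs [(g, s)] with [g] a monomial in the variables [ws] of degree [k]
   and [s] bounded by the class sums of [g]. The offset [z] makes the count
   recursive in [ws]. *)
Definition cseries (ws : seq 'I_n) (z : 'I_q -> int) : fser :=
  fun k => \sum_(g <- monos ws k) \prod_j (1 + z j + (csum g j)%:Z).

Definition csize (ws : seq 'I_n) (j : 'I_q) : int := (count (fun w => c w == j) ws)%:Z.

Lemma csumE g j : csum g j = (\sum_(w | c w == j) g w)%N.
Proof. exact: mnmE. Qed.

Lemma csumD g h j : csum (g + h) j = (csum g j + csum h j)%N.
Proof. by rewrite !mnmE -big_split; apply: eq_bigr => w _; rewrite mnmDE. Qed.

Lemma csumU w i j : csum (U_(w) *+ i) j = ((c w == j) * i)%N.
Proof.
rewrite mnmE; case: eqP => [cw|cw].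
  rewrite (bigD1 w) ?cw //= mulmnE mnm1E eqxx big1 ?addn0 // => w' /andP[_ ww].
  by rewrite mulmnE mnm1E eq_sym (negPf ww).
rewrite big1 // => w' cw'; rewrite mulmnE mnm1E; case: eqP => // e.
by case: cw; rewrite e; exact/eqP.
Qed.

(** The exponent i of w is absorbed into the offset of the class of w. *)
Lemma cseries_cons w ws z k : cseries (w :: ws) z k =
  \sum_(i < k.+1) cseries ws (fun j => z j + (c w == j)%:Z * i%:Z) (k - i)%N.
Proof.
rewrite /cseries monos_cons big_allpairs_dep -[iota 0 k.+1]/(index_iota 0 k.+1) big_mkord.
apply: eq_bigr => i _; apply: eq_bigr => g _; apply: eq_bigr => j _.
by rewrite csumD csumU; lia.
Qed.

(** Induction on [ws]. The exponent i of the new vertex enters only the factor of its class, and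
    linearly; summing over i multiplies the constant part by 1/(1 - t) and the linear part by t/(1 -
    t)^2. *)
Lemma cseriesE ws z : (1 - tser) ^+ (size ws + q) * cseries ws z =
  \prod_j ((1 + z j)%:~R * (1 - tser) + (csize ws j)%:~R * tser).
Proof.
elim: ws z => [|w ws IH] z.
  have -> : cseries [::] z = \prod_j (1 + z j)%:~R.
    rewrite -rmorph_prod; apply/funext => k; rewrite /cseries /=.
    rewrite -[_%:~R]mulr1 intr_coef [(1 : fser) k]coef1; case: k => [|k] /=.
      rewrite big_seq1 mulr1; apply: eq_bigr => j _; rewrite mnmE big1 ?addr0 //.
      by move=> w _; rewrite mnm0E.
    by rewrite big_nil mulr0.
  rewrite add0n -[X in _ ^+ X]card_ord -prodr_const -big_split /=.
  by apply: eq_bigr => j _; rewrite mul0r addr0 mulrC.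
pose s : fser := 1 - tser.
pose f j := (1 + z j)%:~R * s + (csize ws j)%:~R * tser.
pose P := \prod_(j | j != c w) f j.
pose A := f (c w) * P; pose E := (size ws + q)%N.
have splitA (g : 'I_q -> fser) : \prod_j g j = g (c w) * \prod_(j | j != c w) g j.
  by rewrite (bigD1 (c w)).
have IHi (i : nat) : cseries ws (fun j => z j + (c w == j)%:Z * i%:Z) =
    geo ^+ E * A + i%:~R * (geo ^+ E * (s * P)).
  have -> : geo ^+ E * A + i%:~R * (geo ^+ E * (s * P)) = geo ^+ E * (A + i%:~R * (s * P)).
    by ring.
  apply: s_eq; rewrite IH splitA eqxx (mul1r (i : int)).
  have -> : \prod_(j | j != c w) ((1 + (z j + (c w == j)%:Z * i%:Z))%:~R * s
      + (csize ws j)%:~R * tser) = P.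
    apply: eq_bigr => j; rewrite eq_sym => /negPf ->.
    by rewrite mul0r addr0.
  by rewrite /A /f !intrD -/s; ring.
have -> : cseries (w :: ws) z = geo * (geo ^+ E * A) + (tser * geo ^+ 2) * (geo ^+ E * (s * P)).
  apply/funext => k; rewrite cseries_cons fserD !fserM -big_split /=.
  apply: eq_bigr => i _; rewrite IHi fserD intr_coef tgeo2_coef.
  by rewrite [geo i]/geo mul1r.
have sg : s * geo = 1 by exact: geoV.
have sgE l : s ^+ l * geo ^+ l = 1 by rewrite -exprMn sg expr1n.
rewrite /= addSn -/s -/E splitA.
have -> : \prod_(j | j != c w) ((1 + z j)%:~R * s + (csize (w :: ws) j)%:~R * tser) = P.
  by apply: eq_bigr => j; rewrite /csize /= eq_sym => /negPf ->.
have -> : (csize (w :: ws) (c w))%:~R = 1 + (csize ws (c w))%:~R :> fser.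
  by rewrite /csize /= eqxx add1n -addn1 PoszD rmorphD addrC.
transitivity ((s ^+ E * geo ^+ E) * ((s * geo) * (A + tser * (s * geo) * P))).
  by rewrite exprS; ring.
by rewrite sgE sg /A /f; ring.
Qed.

End ClusterSeries.

Section Cluster.
Variables (K : fieldType) (n q : nat) (c : 'I_n -> 'I_q) (e : rel 'I_n) (U : {set 'I_n}).
Local Notation S := {mpoly K[n + n]}.
Local Notation T := {mpoly K[q + n]}.
Implicit Types (m : 'X_{1..n + n}) (g a : 'X_{1..n}) (s : 'X_{1..q}) (w u : 'I_n).

(* [e] restricted to the complement of [U] is a disjoint union of cliques, the
   fibers of [c]. *)
Definition clustered :=
  forall i j, i \notin U -> j \notin U -> (i == j) || e i j = (c i == c j).

Hypothesis cl : clustered.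

(** The parametrization x_w = r_w s_(c w), y_w = r_w: the ratio x_w / y_w depends only on the clique
    of w, so the minors of its edges vanish. In T the variables s come before the r. *)
Definition tvar (i : 'I_(n + n)) : T :=
  if vert i \in U then 0 else
  match split i with
  | inl w => 'X_(rshift q w) * 'X_(lshift n (c w))
  | inr w => 'X_(rshift q w)
  end.

Definition toric : S -> T := subst tvar.

HB.instance Definition _ := GRing.RMorphism.on toric.

Lemma toric_xv w : toric (xv K w) =
  if w \in U then 0 else 'X_(rshift q w) * 'X_(lshift n (c w)).
Proof. by rewrite /toric substX /tvar vert_lshift (unsplitK (inl w)). Qed.

Lemma toric_yv w : toric (yv K w) = if w \in U then 0 else 'X_(rshift q w).
Proof. by rewrite /toric substX /tvar vert_rshift (unsplitK (inr w)). Qed.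

Lemma toric_J p : J e U p -> toric p = 0.
Proof.
elim=> [|b r p' gr _ IH]; first exact: rmorph0.
rewrite rmorphD rmorphM /= IH addr0; case: gr => [i j eij|u uU|u uU].
- rewrite rmorphB !rmorphM /= !toric_xv !toric_yv.
  case: (boolP (i \in U)) => iU; case: (boolP (j \in U)) => jU;
    rewrite ?(mul0r, mulr0, subrr) //.
  by have := cl iU jU; rewrite eij orbT => /esym/eqP <-; ring.
- by rewrite toric_xv uU mulr0.
- by rewrite toric_yv uU mulr0.
Qed.

Definition xdeg m : 'X_{1..n} := [multinom m (lshift n w) | w < n].
Definition vdeg m : 'X_{1..n} := [multinom (m (lshift n w) + m (rshift n w))%N | w < n].

Lemma xdegE m w : xdeg m w = m (lshift n w). Proof. exact: mnmE. Qed.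

Lemma vdegE m w : vdeg m w = (m (lshift n w) + m (rshift n w))%N.
Proof. exact: mnmE. Qed.

Definition alive m := forall w, w \in U -> vdeg m w = 0%N.

Definition pairm g s : 'X_{1..q + n} :=
  [multinom match split i with inl j => s j | inr w => g w end | i < q + n].

Lemma pairm_lshift g s j : pairm g s (lshift n j) = s j.
Proof. by rewrite mnmE (unsplitK (inl j)). Qed.

Lemma pairm_rshift g s w : pairm g s (rshift q w) = g w.
Proof. by rewrite mnmE (unsplitK (inr w)). Qed.

Lemma pairm_inj g s g' s' : pairm g s = pairm g' s' -> g = g' /\ s = s'.
Proof.
move=> /mnmP E; split; apply/mnmP => i.
  by have := E (rshift q i); rewrite !pairm_rshift.
by have := E (lshift n i); rewrite !pairm_lshift.
Qed.

(** The image retains exactly the degree of the monomial at each vertex and the total x-degree in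
    each clique, the two invariants of [straighten]. *)
Lemma toricX m : alive m -> toric 'X_[m] = 'X_[pairm (vdeg m) (csum c (xdeg m))].
Proof.
move=> am; rewrite /toric /subst mmapX /mmap1 big_split_ord /=.
have powX N (i : 'I_N) k : 'X_i ^+ k = 'X_[U_(i) *+ k] :> {mpoly K[N]} by rewrite mpolyXn.
transitivity (\prod_(w < n) ('X_(rshift q w) ^+ vdeg m w * 'X_(lshift n (c w)) ^+ xdeg m w) : T).
  rewrite -big_split; apply: eq_bigr => w _ /=.
  rewrite /tvar vert_lshift vert_rshift (unsplitK (inl w)) (unsplitK (inr w)).
  rewrite !mnmE; case: ifP => wU.
    have /eqP := am w wU; rewrite mnmE addn_eq0 => /andP[/eqP -> /eqP ->].
    by rewrite !expr0 !mulr1.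
  by rewrite exprMn exprD; ring.
rewrite big_split /= mpolyXE_id big_split_ord /= mulrC; congr (_ * _); last first.
  by apply: eq_bigr => w _; rewrite pairm_rshift.
rewrite (partition_big c predT) //=; apply: eq_bigr => j _.
rewrite pairm_lshift mnmE expr_sum.
by apply: eq_bigr => w /eqP ->.
Qed.

Lemma dead_J m u : u \in U -> vdeg m u != 0%N -> J e U ('X_[m] : S).
Proof.
move=> uU; rewrite mnmE addn_eq0 negb_and => /orP[] m0.
  have le : (U_(lshift n u) <= m)%MM by rewrite lep1mP.
  by rewrite -(submK le) mpolyXD; apply: gidealM; exact/gideal_gen/egen_x.
have le : (U_(rshift n u) <= m)%MM by rewrite lep1mP.
by rewrite -(submK le) mpolyXD; apply: gidealM; exact/gideal_gen/egen_y.
Qed.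

(* Straightening: trade [x_w y_u] for [x_u y_w] inside a clique until the
   exponents of the x's agree. *)
Lemma straighten m m' : alive m -> vdeg m = vdeg m' ->
  csum c (xdeg m) = csum c (xdeg m') -> J e U ('X_[m] - 'X_[m'] : S).
Proof.
(* The measure is the total excess of the x-exponents of m over those of m', by truncated
   subtraction. *)
have [N] := ubnP (\sum_w (xdeg m w - xdeg m' w))%N; elim: N m => // N IH m ltN am vv cc.
have [le|] := boolP [forall w, (xdeg m w <= xdeg m' w)%N].
  have xx : xdeg m = xdeg m'.
    apply/mnmP => w; have := congr1 (fun s => s (c w)) cc.
    rewrite /= !csumE (bigD1 w) //= [in RHS](bigD1 w) //=.
    have: (\sum_(i | (c i == c w) && (i != w)) xdeg m i <=
           \sum_(i | (c i == c w) && (i != w)) xdeg m' i)%N.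
      by apply: leq_sum => i _; exact: (forallP le).
    move=> le2 E; apply/eqP; rewrite eqn_leq (forallP le) /=.
    by move: le2; rewrite -(leq_add2l (xdeg m w)) E leq_add2r.
  suff -> : m = m' by rewrite subrr; exact: gideal0.
  apply/mnmP => i; rewrite -(splitK i); case: (split i) => w /=.
    by have := congr1 (fun g => g w) xx; rewrite !mnmE.
  have := congr1 (fun g => g w) xx; have := congr1 (fun g => g w) vv.
  by rewrite !mnmE => E1 E2; move: E1; rewrite E2 => /addnI.
rewrite negb_forall => /existsP[w]; rewrite -ltnNge => lt_w.
have [u /andP[/eqP cu lt_u]] : exists u, (c u == c w) && (xdeg m u < xdeg m' u)%N.
  apply/existsP; rewrite -[X in is_true X]negbK negb_exists; apply/negP => /forallP H.
  have := congr1 (fun s => s (c w)) cc.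
  rewrite /= !csumE (bigD1 w) //= [in RHS](bigD1 w) //=.
  have: (\sum_(i | (c i == c w) && (i != w)) xdeg m' i <=
           \sum_(i | (c i == c w) && (i != w)) xdeg m i)%N.
    apply: leq_sum => i /andP[ci _]; have := H i.
    by rewrite negb_and ci /= -leqNgt.
  by move=> le2 E; have := leq_add lt_w le2; rewrite addSn E ltnn.
have uw : u != w by apply: contraTneq lt_u => ->; rewrite -leqNgt ltnW.
have amw v : (0 < vdeg m v)%N -> v \notin U.
  by move=> v0; apply/negP => /am v0'; rewrite v0' in v0.
have vu := congr1 (fun g => g u) vv; rewrite /= !vdegE in vu; rewrite !xdegE in lt_u lt_w.
have wU : w \notin U by apply: amw; rewrite vdegE; lia.
have uU : u \notin U by apply: amw; rewrite vdegE; lia.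
have ewu : e w u.
  by have := cl wU uU; rewrite cu eqxx eq_sym (negPf uw).
pose m0 := (m - (U_(lshift n w) + U_(rshift n u)))%MM.
have le0 : (U_(lshift n w) + U_(rshift n u) <= m)%MM.
  apply/mnm_lepP => i; rewrite mnmDE !mnm1E.
  case: eqP => [<-|_]; rewrite ?eq_rlshift ?eq_lrshift.
    by rewrite addn0; lia.
  by case: eqP => [<-|_] //; lia.
pose m1 := (m0 + (U_(lshift n u) + U_(rshift n w)))%MM.
have mE : m = (m0 + (U_(lshift n w) + U_(rshift n u)))%MM by rewrite submK.
have mx v : (m (lshift n v) = m0 (lshift n v) + (w == v))%N.
  by rewrite {1}mE !mnmDE !mnm1E eq_lshift eq_rlshift addn0.
have my v : (m (rshift n v) = m0 (rshift n v) + (u == v))%N.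
  by rewrite {1}mE !mnmDE !mnm1E eq_rshift eq_lrshift.
have m1x v : (m1 (lshift n v) = m0 (lshift n v) + (u == v))%N.
  by rewrite !mnmDE !mnm1E eq_lshift eq_rlshift addn0.
have m1y v : (m1 (rshift n v) = m0 (rshift n v) + (w == v))%N.
  by rewrite !mnmDE !mnm1E eq_rshift eq_lrshift.
have v1 : vdeg m1 = vdeg m.
  by apply/mnmP => v; rewrite !vdegE m1x m1y mx my; lia.
have c1 : csum c (xdeg m1) = csum c (xdeg m).
  have E v : (xdeg m1 v + (w == v) = xdeg m v + (u == v))%N by rewrite !xdegE mx m1x; lia.
  apply/mnmP => j.
  have : (csum c (xdeg m1) j + csum c U_(w) j = csum c (xdeg m) j + csum c U_(u) j)%N.
    rewrite -!csumD !csumE; apply: eq_bigr => v _.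
    by rewrite !mnmDE !mnm1E E.
  by rewrite -[U_(w)%MM]mulm1n -[U_(u)%MM]mulm1n !csumU cu => /addIn.
have -> : 'X_[m] - 'X_[m'] = 'X_[m0] * edge_poly K w u + ('X_[m1] - 'X_[m']) :> S.
  by rewrite mE !mpolyXD /edge_poly /xv /yv; ring.
apply: gidealD; first by apply: gidealM; exact: J_edge.
apply: IH; rewrite ?v1 ?c1 //; last by move=> v; rewrite v1; exact: am.
apply: (leq_trans _ (ltN : (_ <= N)%N)).
rewrite (bigD1 w) //= [in X in (_ < X)%N](bigD1 w) //= -addSn; apply: leq_add.
  by rewrite !xdegE m1x (negPf uw); move: lt_w; rewrite mx eqxx; lia.
apply: leq_sum => v vw; rewrite !xdegE m1x mx [w == v]eq_sym (negPf vw) addn0.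
by case: eqP => [<-|_] /=; rewrite ?addn0 //; move: lt_u; rewrite mx eq_sym (negPf uw); lia.
Qed.

(** Built one unit at a time: while the class sum of a is below that of g, some exponent in the
    class still has room. *)
Lemma ex_xdeg g s : (forall j, s j <= csum c g j)%N ->
  exists2 a, (a <= g)%MM & csum c a = s.
Proof.
have [N] := ubnP (mdeg s); elim: N s => // N IH s ltN sg.
have [->|s0] := eqVneq s 0%MM.
  exists 0%MM; first by apply/mnm_lepP => i; rewrite mnm0E.
  by apply/mnmP => j; rewrite mnmE mnm0E big1 // => w _; rewrite mnm0E.
have [j sj] : exists j, s j != 0%N.
  apply/existsP; rewrite -[X in is_true X]negbK negb_exists; apply: contra s0 => /forallP H.
  by apply/eqP/mnmP => j; rewrite mnm0E; apply/eqP; rewrite -[_ == _]negbK.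
have le : (U_(j) <= s)%MM by rewrite lep1mP.
have [||a /mnm_lepP ag ca] := IH (s - U_(j))%MM.
- by rewrite -ltnS; apply: leq_trans ltN; rewrite ltnS -{2}(submK le) mdegD mdeg1 addn1.
- by move=> i; apply: leq_trans (sg i); rewrite mnmBE leq_subr.
have [w /andP[/eqP cw aw]] : exists w, (c w == j) && (a w < g w)%N.
  apply/existsP; rewrite -[X in is_true X]negbK negb_exists; apply/negP => /forallP H.
  have: (csum c g j <= csum c a j)%N.
    rewrite !csumE; apply: leq_sum => w cw; have := H w.
    by rewrite negb_and cw /= -leqNgt.
  by rewrite ca mnmBE mnm1E eqxx; have := sg j; move: sj; lia.
exists (a + U_(w))%MM.
  apply/mnm_lepP => w'; rewrite mnmDE mnm1E; case: eqP => [<-|_]; first by rewrite addn1.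
  by rewrite addn0; exact: ag.
apply/mnmP => i; rewrite csumD -[U_(w)%MM]mulm1n csumU ca muln1 mnmBE mnm1E cw.
by case: eqP => [<-|_] /=; lia.
Qed.

(** Stated for all pairs, with a junk monomial outside the box, so that [choice] yields a
    function. *)
Lemma ex_mono (x : 'X_{1..n} * 'X_{1..q}) : exists m,
  x.2 \in box (csum c x.1) -> vdeg m = x.1 /\ csum c (xdeg m) = x.2.
Proof.
have [|xs] := boolP (x.2 \in box _); last by exists 0%MM.
rewrite mem_box => /forallP/ex_xdeg[a /mnm_lepP ag ca].
exists [multinom match split i with inl w => a w | inr w => (x.1 w - a w)%N end | i < n + n].
move=> _; split.
  by apply/mnmP => w; rewrite !mnmE (unsplitK (inl w)) (unsplitK (inr w)) subnKC.
by rewrite -ca; congr csum; apply/mnmP => w; rewrite !mnmE (unsplitK (inl w)).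
Qed.

Lemma mdeg_vdeg m : mdeg (vdeg m) = mdeg m.
Proof.
rewrite !mdegE [RHS]big_split_ord /= -[RHS]big_split; apply: eq_bigr => w _.
exact: vdegE.
Qed.

(** A basis in degree k has one monomial for each pair of a vertex degree g and a vector of clique
    x-degrees below the class sums of g. Independence holds because the toric images are distinct
    monomials; spanning is [straighten] and [dead_J]. *)
Lemma hilb_cluster k :
  (hilb (J (K := K) e U) k)%:Z = cseries c (enum (~: U)) (fun=> 0) k.
Proof.
have /choice[mo moP] := ex_mono.
pose D := [seq (g, s) | g <- monos (enum (~: U)) k, s <- box (csum c g)].
have memD x : (x \in D) = (x.1 \in monos (enum (~: U)) k) && (x.2 \in box (csum c x.1)).
  apply/allpairsPdep/andP => [[g [s [gm sm ->]]] //|[gm sm]].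
  by exists x.1, x.2; split=> //; case: x {gm sm}.
have memm g : (g \in monos (enum (~: U)) k) =
    (mdeg g == k) && [forall w, (w \notin U) || (g w == 0%N)].
  rewrite mem_monos ?enum_uniq //; congr (_ && _); apply: eq_forallb => w.
  by rewrite mem_enum inE.
have uD : uniq D.
  apply: allpairs_uniq_dep; first exact/monos_uniq/enum_uniq.
    by move=> g _; exact: box_uniq.
  by move=> [g s] [g' s'] _ _ /= [-> ->].
have -> : cseries c (enum (~: U)) (fun=> 0) k = (size D)%:Z.
  rewrite size_allpairs_dep sumnE big_map /cseries [RHS](big_morph Posz PoszD (erefl (0 : int))).
  apply: eq_bigr => g _; rewrite size_box [RHS](big_morph Posz PoszM (erefl (1 : int))).
  by apply: eq_bigr => j _; lia.
congr Posz; apply: hilb_eq; first exact: J_subspace.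
have alD x : x \in D -> alive (mo x).
  rewrite memD memm -andbA => /and3P[_ /forallP gU xb] w wU.
  by have [-> _] := moP x xb; have := gU w; rewrite wU => /eqP.
have torD x : x \in D -> toric 'X_[mo x] = 'X_[pairm x.1 x.2].
  move=> xD; rewrite toricX; last exact: alD.
  move: xD; rewrite memD => /andP[_ xb].
  by have [-> ->] := moP x xb.
apply: (qdim_seq (f := fun x : 'X_{1..n} * 'X_{1..q} => 'X_[mo x] : S)) => //.
- move=> x; rewrite memD memm => /andP[/andP[/eqP <- _] xb].
  by apply/dhomogP => m; rewrite msuppX inE => /eqP ->; rewrite /= -mdeg_vdeg (moP x xb).1.
- move=> l /toric_J; rewrite rmorph_sum /= big_seq => E x xD.
  have /(congr1 (mcoeff (pairm x.1 x.2))) : \sum_(i <- D) l i *: 'X_[pairm i.1 i.2] = 0 :> T.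
    rewrite big_seq -[RHS]E; apply: eq_bigr => i iD.
    by rewrite [RHS]substZ; congr (_ *: _); rewrite -torD.
  rewrite raddf_sum mcoeff0 (bigD1_seq x) //= mcoeffZ mcoeffX eqxx mulr1 big1 ?addr0 //.
  move=> i ix; rewrite mcoeffZ mcoeffX; case: eqP => [/pairm_inj[i1 i2]|_]; last by rewrite mulr0.
  by case/eqP: ix; case: i i1 i2 => ? ? /= -> ->; case: x {xD}.
- move=> p /dhomogP hp.
  have mono m : mdeg m = k -> exists l, J e U ('X_[m] - \sum_(x <- D) l x *: 'X_[mo x] : S).
    move=> mk; have [/forallP am|] := boolP [forall w, (w \notin U) || (vdeg m w == 0%N)].
      pose x := (vdeg m, csum c (xdeg m)).
      have xb : x.2 \in box (csum c x.1).
        rewrite mem_box; apply/forallP => j; rewrite !mnmE.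
        by apply: leq_sum => w _; rewrite !mnmE leq_addr.
      have xD : x \in D.
        by rewrite memD xb andbT memm mdeg_vdeg mk eqxx; apply/forallP.
      exists (fun y => (y == x)%:R); rewrite (bigD1_seq x) //= eqxx scale1r big1 ?addr0.
        have [E1 E2] := moP x xb.
        apply: straighten; rewrite ?E1 ?E2 //.
        by move=> w wU; have := am w; rewrite wU => /eqP.
      by move=> y /negPf ->; rewrite scale0r.
    rewrite negb_forall => /existsP[w]; rewrite negb_or negbK => /andP[wU w0].
    exists (fun=> 0); rewrite big1 ?subr0; last by move=> x _; rewrite scale0r.
    exact: dead_J w0.
  have /choice[l lP] : forall m, exists l, mdeg m = k ->
      J e U ('X_[m] - \sum_(x <- D) l x *: 'X_[mo x] : S).
    move=> m; have [/eqP/mono[l ?]|ne] := boolP (mdeg m == k); first by exists l.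
    by exists (fun=> 0) => /eqP; rewrite (negPf ne).
  exists (fun x => \sum_(m <- msupp p) p@_m * l m x).
  have -> : \sum_(x <- D) (\sum_(m <- msupp p) p@_m * l m x) *: 'X_[mo x] =
      \sum_(m <- msupp p) p@_m *: \sum_(x <- D) l m x *: 'X_[mo x] :> S.
    under eq_bigr do rewrite scaler_suml.
    rewrite exchange_big; apply: eq_bigr => m _; rewrite scaler_sumr.
    by apply: eq_bigr => x _; rewrite scalerA.
  rewrite [X in X - _]mpolyE -sumrB big_seq; apply: gideal_sum => m mp.
  rewrite -scalerBr -mul_mpolyC; apply: gidealM; apply: lP; exact: hp.
Qed.

End Cluster.

(** * The Hilbert series of a gluing *)

Section OhtaniInduction.
Variable n : nat.
Implicit Types (e : rel 'I_n) (U : {set 'I_n}) (u : 'I_n).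

(** Freeness of u among the live vertices, those outside U, expressed without maximal cliques. *)
Definition simplicial e U u := forall i j, i \notin U -> j \notin U -> i != j ->
  e u i -> e u j -> e i j.

(* [saturate e u] has strictly more edges than [e] unless [u] is simplicial, and
   deleting [u] leaves fewer vertices. *)
Lemma ohtani_ind (Inv P : rel 'I_n -> {set 'I_n} -> Prop) (A : {set 'I_n}) :
  (forall e U u, Inv e U -> u \in A -> u \notin U ->
    Inv (saturate e u) U /\ Inv e (u |: U)) ->
  (forall e U, Inv e U ->
    (forall u, u \in A -> u \notin U -> simplicial e U u) -> P e U) ->
  (forall e U u, Inv e U -> u \in A -> u \notin U -> P (saturate e u) U ->
    P e (u |: U) -> P (saturate e u) (u |: U) -> P e U) ->
  forall e U, Inv e U -> P e U.
Proof.
move=> closed base step e U.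
pose nonedge e U := [set ij : 'I_n * 'I_n | [&& ij.1 \notin U, ij.2 \notin U & ~~ e ij.1 ij.2]].
(* Lexicographic order on live vertices, then on non-edges: the factor n * n + 1 exceeds any number
   of non-edges. *)
pose mu e U := (#|~: U| * (n * n).+1 + #|nonedge e U|)%N.
have [N] := ubnP (mu e U); elim: N e U => // N IH e U ltN ieU.
have [all_free|] := pselect (forall u, u \in A -> u \notin U -> simplicial e U u).
  exact: base.
move=> /existsNP[u /not_implyP[uA /not_implyP[uU nf]]].
have [ise iek] := closed _ _ _ ieU uA uU.
have [_ isk] := closed _ _ _ ise uA uU.
have mu_kill e' : (mu e' (u |: U) < mu e U)%N.
  have cU : #|~: U| = #|~: (u |: U)|.+1.
    rewrite (cardsD1 u (~: U)) in_setC uU add1n.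
    by have -> : ~: (u |: U) = (~: U) :\ u by apply/setP => i; rewrite !inE negb_or.
  have: (#|nonedge e' (u |: U)| <= n * n)%N 
    by rewrite (leq_trans (max_card _)) // card_prod card_ord.
  rewrite /mu cU mulSn; set B := (#|~: (u |: U)| * _)%N.
  by move: #|_| #|_| (n * n)%N => a b m; lia.
have mu_sat : (mu (saturate e u) U < mu e U)%N.
  rewrite /mu ltn_add2l; apply: proper_card; apply/properP; split.
    apply/subsetP => ij; rewrite !inE => /and3P[-> ->] /=.
    by apply: contra; rewrite /saturate => ->.
  move: nf => /existsNP[i /existsNP[j]].
  move=> /not_implyP[iU /not_implyP[jU /not_implyP[ij /not_implyP[eui /not_implyP[euj neij]]]]].
  exists (i, j); first by rewrite inE iU jU /=; exact/negP.
  by rewrite inE /= /saturate ij eui euj orbT iU jU.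
have lt x : (x < mu e U -> x < N)%N by move=> lx; exact: leq_trans lx ltN.
by apply: (step e U u) => //; apply: IH => //; apply: lt.
Qed.

Lemma saturate_sym e u : ssrbool.symmetric e -> ssrbool.symmetric (saturate e u).
Proof. by move=> es i j; rewrite /saturate es eq_sym [e u i && _]andbC. Qed.

(** If all live vertices are simplicial, being equal or adjacent is transitive; each class is named
    by the vertex that [pick] selects in it. *)
Lemma simplicial_clustered e U : ssrbool.symmetric e ->
  (forall u, u \notin U -> simplicial e U u) -> exists c : 'I_n -> 'I_n, clustered c e U.
Proof.
move=> es sp; pose R i j := (i == j) || e i j.
have Rs : ssrbool.symmetric R by move=> i j; rewrite /R es eq_sym.
have Rt i j k : i \notin U -> j \notin U -> k \notin U -> R i j -> R j k -> R i k.
  move=> iU jU kU /orP[/eqP -> //|eij] /orP[/eqP <-|ejk]; first by rewrite /R eij orbT.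
  rewrite /R; case: eqVneq => //= ik; apply: (sp j) => //; by rewrite es.
exists (fun i => odflt i [pick j | (j \notin U) && R i j]) => i j iU jU.
have pickR k : k \notin U ->
    let l := odflt k [pick j | (j \notin U) && R k j] in l \notin U /\ R k l.
  move=> kU /=; case: pickP => [l /andP[]//|/(_ k)].
  by rewrite kU /R eqxx.
apply/idP/eqP => [Rij|E].
  rewrite (@eq_pick _ _ (fun k => (k \notin U) && R j k)).
    by case: pickP => // /(_ j); rewrite jU /R eqxx.
  move=> k /=; case kU : (k \in U) => //=.
  apply/idP/idP; last by apply: Rt => //; rewrite kU.
  by apply: Rt; rewrite ?kU // Rs.
have [lU Ril] := pickR i iU; have [_] := pickR j jU; rewrite -E Rs.
exact: Rt.
Qed.

End OhtaniInduction.

Definition hilbser (K : fieldType) m (I : {mpoly K[m]} -> Prop) : fser :=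
  fun k => (hilb I k)%:Z.

Section HilbertSeriesOf.
Variables (K : fieldType) (n : nat).
Implicit Types (e : rel 'I_n) (U : {set 'I_n}) (u : 'I_n).

Definition hser e U : fser := hilbser (J (K := K) e U).

Lemma hser_ohtani e U u :
  hser e U = hser (saturate e u) U + hser e (u |: U) - hser (saturate e u) (u |: U).
Proof.
apply/funext => k; rewrite fserB fserD /hser /hilbser.
by have := hilb_ohtani K e U u k; lia.
Qed.

Lemma J_dead e U i j : (i \in U) || (j \in U) -> J (K := K) e U (edge_poly K i j).
Proof.
case/orP=> H; apply: gidealB; rewrite ?[_ * yv K j]mulrC; 
  by [apply: gidealM; exact/gideal_gen/egen_x|apply: gidealM; exact/gideal_gen/egen_y|
      apply: gidealMr; exact/gideal_gen/egen_x|apply: gidealMr; exact/gideal_gen/egen_y].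
Qed.

(** The polynomial of an edge at a dead vertex is already in the ideal and that of a loop is 0, so
    only edges between distinct live vertices count. *)
Lemma J_off e e' U p :
  (forall i j, i \notin U -> j \notin U -> i != j -> e i j -> e' i j) ->
  J (K := K) e U p -> J (K := K) e' U p.
Proof.
move=> ee'; apply: J_mono => // i j eij.
have [H|] := boolP ((i \in U) || (j \in U)); first exact: J_dead.
rewrite negb_or => /andP[iU jU]; have [->|ij] := eqVneq i j.
  by rewrite /edge_poly subrr; exact: gideal0.
by apply: J_edge; exact: ee'.
Qed.

Lemma hser_off e e' U :
  (forall i j, i \notin U -> j \notin U -> i != j -> e i j = e' i j) -> hser e U = hser e' U.
Proof.
move=> ee'; apply/funext => k; congr Posz; apply: hilb_ext; first exact: J_subspace.
by move=> p; split; apply: J_off => i j iU jU ij; rewrite ee'.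
Qed.

(** An empty class contributes a factor 1 - t, which balances its share of the exponent q. *)
Lemma hser_cluster q (c : 'I_n -> 'I_q) e U : clustered c e U ->
  (1 - tser) ^+ (#|~: U| + q) * hser e U =
  \prod_j ((1 - tser) + #|[set w in ~: U | c w == j]|%:R * tser).
Proof.
move=> cl; have -> : hser e U = cseries c (enum (~: U)) (fun=> 0).
  by apply/funext => k; exact: hilb_cluster.
rewrite cardE cseriesE; apply: eq_bigr => j _; rewrite addr0 mul1r; congr (_ + _ * _).
rewrite /csize cardE -size_filter -pmulrn; congr (_%:R); congr size.
by rewrite /enum_mem -filter_predI; apply: eq_filter => w; rewrite !inE andbC.
Qed.

End HilbertSeriesOf.

(** * Gluing two graphs at a free vertex *)

Section Gluing.
Variables (K : fieldType) (n : nat) (V1 V2 : {set 'I_n}) (v : 'I_n).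
Hypotheses (V12 : V1 :|: V2 = [set: 'I_n]) (Vv : V1 :&: V2 = [set v]).
Implicit Types (e : rel 'I_n) (U : {set 'I_n}) (u : 'I_n).

(** The hypotheses of the theorem for the live part of e, in a form that the recursion preserves: no
    live edge crosses, and v is simplicial on each side. *)
Definition glued e U := [/\ ssrbool.symmetric e, v \notin U,
  forall i j, i \notin U -> j \notin U -> e i j ->
    (i \in V1) && (j \in V1) || (i \in V2) && (j \in V2),
  simplicial e (U :|: ~: V1) v & simplicial e (U :|: ~: V2) v].

Let v1 : v \in V1. Proof. by have := set11 v; rewrite -Vv inE => /andP[]. Qed.
Let v2 : v \in V2. Proof. by have := set11 v; rewrite -Vv inE => /andP[]. Qed.
Let inV i : (i \in V1) || (i \in V2).
Proof. by have := in_setT i; rewrite -V12 inE. Qed.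
Let inVv i : i \in V1 -> i \in V2 -> i = v.
Proof. by move=> i1 i2; apply/set1P; rewrite -Vv inE i1. Qed.

Lemma glued_nbr1 e U u i : glued e U -> u \notin U -> i \notin U -> u \in V1 -> u != v ->
  e u i -> i \in V1.
Proof.
move=> [_ _ ed _ _] uU iU u1 uv /(ed _ _ uU iU) /orP[/andP[]//|/andP[u2 _]].
by rewrite (inVv u1 u2) eqxx in uv.
Qed.

Lemma glued_nbr2 e U u i : glued e U -> u \notin U -> i \notin U -> u \in V2 -> u != v ->
  e u i -> i \in V2.
Proof.
move=> [_ _ ed _ _] uU iU u2 uv /(ed _ _ uU iU) /orP[/andP[u1 _]|/andP[]//].
by rewrite (inVv u1 u2) eqxx in uv.
Qed.

(** A new edge at v requires u to be adjacent to v. A neighbour of v is then a neighbour of u, as v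
    is simplicial, and saturation joins it to all neighbours of u. The hypothesis on j ensures that
    u is live when this is used. *)
Lemma simplicial_saturate e U u : ssrbool.symmetric e -> v \notin U ->
  (forall j, j \notin U -> v != j -> e u v -> e u j -> u \notin U) ->
  simplicial e U v -> simplicial (saturate e u) U v.
Proof.
move=> es vU uU sv i j iU jU ij; rewrite /saturate ij /=.
have mixed a b : a \notin U -> b \notin U -> a != b -> v != b ->
    e v a -> e u v -> e u b -> e a b || e u a && e u b.
  move=> aU bU ab vb eva euv eub; rewrite eub andbT.
  have [->|au] := eqVneq a u; first by rewrite eub.
  by rewrite (sv u a) ?orbT ?(uU b) // 1?eq_sym // es.
case/orP=> [evi|/and3P[vi euv eui]]; case/orP=> [evj|/and3P[vj euv' euj]].
- by rewrite sv.
- exact: mixed.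
- by rewrite es andbC mixed // eq_sym.
- by rewrite eui euj orbT.
Qed.

(** All live neighbours of u lie on its side, so saturation creates no crossing edge; on the
    opposite side u meets at most v, and nothing changes there. *)
Lemma glued_closed e U u : glued e U -> u \in ~: [set v] -> u \notin U ->
  glued (saturate e u) U /\ glued e (u |: U).
Proof.
move=> gl; rewrite !inE => uv uU; have [es vU ed s1 s2] := gl; split; split=> //.
- exact: saturate_sym.
- move=> i j iU jU /orP[|/and3P[_ eui euj]]; first exact: ed.
  case/orP: (inV u) => uV.
    by rewrite (glued_nbr1 gl uU iU uV uv eui) (glued_nbr1 gl uU jU uV uv euj).
  by rewrite (glued_nbr2 gl uU iU uV uv eui) (glued_nbr2 gl uU jU uV uv euj) orbT.
- apply: simplicial_saturate; rewrite ?inE ?negb_or ?vU ?negbK ?v1 // => j.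
  rewrite !inE !negb_or !negbK uU => /andP[jU jV] vj _ euj /=; case/orP: (inV u) => // uV.
  by rewrite (inVv jV (glued_nbr2 gl uU jU uV uv euj)) eqxx in vj.
- apply: simplicial_saturate; rewrite ?inE ?negb_or ?vU ?negbK ?v2 // => j.
  rewrite !inE !negb_or !negbK uU => /andP[jU jV] vj _ euj /=; case/orP: (inV u) => // uV.
  by rewrite (inVv (glued_nbr1 gl uU jU uV uv euj) jV) eqxx in vj.
- by rewrite !inE negb_or eq_sym uv.
- by move=> i j; rewrite !inE !negb_or => /andP[_ iU] /andP[_ jU]; exact: ed.
- move=> i j; rewrite !inE !negb_or -!andbA => /and3P[_ iU iV] /and3P[_ jU jV].
  by apply: s1; rewrite !inE negb_or ?iU ?jU.
- move=> i j; rewrite !inE !negb_or -!andbA => /and3P[_ iU iV] /and3P[_ jU jV].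
  by apply: s2; rewrite !inE negb_or ?iU ?jU.
Qed.

Local Notation H e U := (hser K e U).

Definition glue_identity e U :=
  H e U = (1 - tser) ^+ 2 * (H e (U :|: ~: V1) * H e (U :|: ~: V2)).

(** In the factor of the opposite side u is already deleted, and saturation adds no live edge,
    having at most v to join. That factor is thus common to the three identities, and [hser_ohtani]
    recombines the other one. *)
Lemma glue_step e U u : glued e U -> u \in ~: [set v] -> u \notin U ->
  glue_identity (saturate e u) U -> glue_identity e (u |: U) ->
  glue_identity (saturate e u) (u |: U) -> glue_identity e U.
Proof.
rewrite /glue_identity !inE => gl uv uU Is Ik Isk.
rewrite (hser_ohtani K e U u) Is Ik Isk -!setUA.
have sat_off (W : {set 'I_n}) : u \in W -> (forall i j, i \notin U :|: W -> j \notin U :|: W ->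
    i != j -> ~~ (e u i && e u j)) -> H (saturate e u) (U :|: W) = H e (U :|: W).
  move=> uW no; apply: hser_off => i j iU jU ij.
  by rewrite /saturate ij (negPf (no _ _ iU jU ij)) orbF.
have U1 (W : {set 'I_n}) : u \in W -> u |: (U :|: W) = U :|: W.
  by move=> uW; apply/setUidPr; rewrite sub1set inE uW orbT.
case/orP: (inV u) => uV.
  have u2 : u \in ~: V2 by rewrite inE; apply: contraNN uv => /(inVv uV) ->.
  rewrite (U1 (~: V2)) // (sat_off (~: V2)) //; last first.
    move=> i j; rewrite !inE !negb_or !negbK => /andP[iU iV] /andP[jU jV] ij.
    apply: contraNN ij => /andP[/(glued_nbr1 gl uU iU uV uv)i1 /(glued_nbr1 gl uU jU uV uv) j1].
    by rewrite (inVv i1 iV) (inVv j1 jV).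
  by rewrite (hser_ohtani K e (U :|: ~: V1) u); ring.
have u1 : u \in ~: V1 by rewrite inE; apply: contraNN uv => /inVv ->.
rewrite (U1 (~: V1)) // (sat_off (~: V1)) //; last first.
  move=> i j; rewrite !inE !negb_or !negbK => /andP[iU iV] /andP[jU jV] ij.
  apply: contraNN ij => /andP[/(glued_nbr2 gl uU iU uV uv)i1 /(glued_nbr2 gl uU jU uV uv) j1].
  by rewrite (inVv iV i1) (inVv jV j1).
by rewrite (hser_ohtani K e (U :|: ~: V2) u); ring.
Qed.

Lemma card_glued1 U (P : pred 'I_n) : v \notin U ->
  #|[set w in ~: (v |: U) | P w]| =
  (#|[set w in V1 :\: (v |: U) | P w]| + #|[set w in V2 :\: (v |: U) | P w]|)%N.
Proof.
move=> vU; rewrite -cardsUI.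
have -> : [set w in V1 :\: (v |: U) | P w] :&: [set w in V2 :\: (v |: U) | P w] = set0.
  apply/setP => w; rewrite !inE; apply/negP.
  move=> /andP[/andP[/andP[wv w1] _] /andP[/andP[_ w2] _]].
  by move: wv; rewrite (inVv w1 w2) eqxx.
rewrite cards0 addn0; apply: eq_card => w; rewrite !inE.
by have := inV w; case: (w \in V1); case: (w \in V2); case: (P w);
  case: ((w == v) || (w \in U)).
Qed.

Lemma card_glued_vertex U (W : {set 'I_n}) (P : pred 'I_n) : v \notin U -> v \in W ->
  #|[set w in ~: (U :|: ~: W) | P w]| = (#|[set w in W :\: (v |: U) | P w]| + P v)%N.
Proof.
move=> vU vW; rewrite addnC (cardsD1 v) !inE (negPf vU) vW /=; congr (_ + _)%N.
apply: eq_card => w; rewrite !inE !negb_or negbK.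
by case: (w == v); case: (w \in U); case: (w \in W); case: (P w).
Qed.

(** The recursion at v. Completing at v merges its cliques on the two sides, deleting v separates
    the sides. All five graphs involved are disjoint unions of cliques, described by the clustering
    c of [saturate e v] or by its refinement c' by sides. *)
Lemma glue_base e U : glued e U ->
  (forall u, u \in ~: [set v] -> u \notin U -> simplicial e U u) -> glue_identity e U.
Proof.
move=> gl sp; have [es vU ed s1 s2] := gl.
have {}sp u : u != v -> u \notin U -> simplicial e U u by move=> uv; apply: sp; rewrite !inE.
have [c cl] : exists c : 'I_n -> 'I_n, clustered c (saturate e v) U.
  apply: simplicial_clustered; first exact: saturate_sym.
  move=> a aU i j iU jU ij.
  have mixed k l : k \notin U -> l \notin U -> k != l -> e a k -> e v a -> e v l ->
      saturate e v k l.
    move=> kU lU kl eak eva evl; rewrite /saturate kl evl andbT /=.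
    have [->|kv] := eqVneq k v; first by rewrite evl.
    have [av|av] := eqVneq a v; first by rewrite -av eak orbT.
    by rewrite (sp a av aU v k) ?orbT // 1?eq_sym // es.
  case/orP=> [eai|/and3P[ai eva evi]]; case/orP=> [eaj|/and3P[aj eva' evj]].
  - have [av|av] := eqVneq a v; first by rewrite /saturate ij -av eai eaj orbT.
    by rewrite /saturate (sp a).
  - exact: mixed.
  - by rewrite saturate_sym // mixed // eq_sym.
  - by rewrite /saturate ij evi evj orbT.
have sat1 i j : i \notin U -> j \notin U -> i \in V1 -> j \in V1 ->
    (i == j) || e i j = (i == j) || saturate e v i j.
  move=> iU jU i1 j1; rewrite /saturate; case: eqVneq => //= ij.
  case eij : (e i j) => //=; apply/esym/negP => /andP[evi evj].
  by move/negP: eij; apply; apply: s1; rewrite ?inE ?negb_or ?negbK ?iU ?jU.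
have sat2 i j : i \notin U -> j \notin U -> i \in V2 -> j \in V2 ->
    (i == j) || e i j = (i == j) || saturate e v i j.
  move=> iU jU i1 j1; rewrite /saturate; case: eqVneq => //= ij.
  case eij : (e i j) => //=; apply/esym/negP => /andP[evi evj].
  by move/negP: eij; apply; apply: s2; rewrite ?inE ?negb_or ?negbK ?iU ?jU.
have cl_sub : clustered c (saturate e v) (v |: U).
  by move=> i j; rewrite !inE !negb_or => /andP[_ iU] /andP[_ jU]; exact: cl.
have cl1 : clustered c e (U :|: ~: V1).
  move=> i j; rewrite !inE !negb_or !negbK => /andP[iU i1] /andP[jU j1].
  by rewrite sat1 // cl.
have cl2 : clustered c e (U :|: ~: V2).
  move=> i j; rewrite !inE !negb_or !negbK => /andP[iU i1] /andP[jU j1].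
  by rewrite sat2 // cl.
have cross i j : i != v -> j != v -> i \notin U -> j \notin U ->
    i \in V1 -> j \notin V1 -> ~~ e i j.
  move=> iv jv iU jU i1 j1; apply/negP => /(ed _ _ iU jU); rewrite (negPf j1) andbF /=.
  by case/andP=> /(inVv i1) E _; rewrite E eqxx in iv.
(* Once v is deleted from e, the merged class of v falls apart into its two sides. *)
pose c' i : 'I_(n + n) := if i \in V1 then lshift n (c i) else rshift n (c i).
have clk : clustered c' e (v |: U).
  move=> i j; rewrite !inE !negb_or => /andP[iv iU] /andP[jv jU]; rewrite /c'.
  case: ifPn => i1; case: ifPn => j1.
  - by rewrite eq_lshift sat1 // cl.
  - rewrite eq_lrshift (negPf (cross _ _ iv jv iU jU i1 j1)) orbF.
    by apply: contraNF j1 => /eqP <-.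
  - rewrite eq_rlshift es (negPf (cross _ _ jv iv jU iU j1 i1)) orbF.
    by apply: contraNF i1 => /eqP ->.
  - rewrite eq_rshift sat2 ?cl //; first by move: (inV i); rewrite (negPf i1).
    by move: (inV j); rewrite (negPf j1).
have Ha := hser_cluster K cl; have Hb := hser_cluster K cl_sub.
have Hc := hser_cluster K clk; have H1 := hser_cluster K cl1; have H2 := hser_cluster K cl2.
rewrite /glue_identity (hser_ohtani K e U v).
pose p j := #|[set w in V1 :\: (v |: U) | c w == j]|.
pose q j := #|[set w in V2 :\: (v |: U) | c w == j]|.
pose d j : nat := c v == j.
have fb j : #|[set w in ~: (v |: U) | c w == j]| = (p j + q j)%N by rewrite card_glued1.
have f1 j : #|[set w in ~: (U :|: ~: V1) | c w == j]| = (p j + d j)%N.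
  by rewrite card_glued_vertex.
have f2 j : #|[set w in ~: (U :|: ~: V2) | c w == j]| = (q j + d j)%N.
  by rewrite card_glued_vertex.
have UT : ~: U = ~: (U :|: ~: [set: 'I_n]) by rewrite setCT setU0.
have UTv : [set: 'I_n] :\: (v |: U) = ~: (v |: U) by rewrite setTD.
have fa j : #|[set w in ~: U | c w == j]| = (p j + q j + d j)%N.
  by rewrite UT card_glued_vertex ?inE // UTv fb.
have fl j : #|[set w in ~: (v |: U) | c' w == lshift n j]| = p j.
  apply: eq_card => w; rewrite !inE /c'; case: (w \in V1); first by rewrite eq_lshift andbT.
  by rewrite eq_rlshift !andbF.
have fr j : #|[set w in ~: (v |: U) | c' w == rshift n j]| = q j.
  apply: eq_card => w; rewrite !inE /c'; have [w1|w1] := boolP (w \in V1).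
    rewrite eq_lrshift andbF; case: eqVneq => //= wv.
    have [w2|//] := boolP (w \in V2); last by rewrite andbF.
    by rewrite (inVv w1 w2) eqxx in wv.
  rewrite eq_rshift; have := inV w; rewrite (negPf w1) /= => ->.
  by rewrite andbT.
(* A clique that does not contain v lies on a single side. *)
have pq j : c v != j -> (p j = 0 \/ q j = 0)%N.
  move=> cj; have [p0|[a]] := set_0Vmem [set w in V1 :\: (v |: U) | c w == j].
    by left; rewrite /p p0 cards0.
  rewrite !inE negb_or => /andP[/andP[/andP[av aU] a1] /eqP ca].
  have [q0|[b]] := set_0Vmem [set w in V2 :\: (v |: U) | c w == j].
    by right; rewrite /q q0 cards0.
  rewrite !inE negb_or => /andP[/andP[/andP[bv bU] b2] /eqP cb].
  have b1 : b \notin V1 by apply: contraNN bv => b1; rewrite (inVv b1 b2).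
  have := cl a b aU bU; rewrite ca cb eqxx.
  have ab : a != b by apply: contraTneq a1 => ->.
  rewrite (negPf ab) /= /saturate (negPf (cross _ _ av bv aU bU a1 b1)) ab /=.
  case/andP=> eva _; have := cl v a vU aU; rewrite ca (negPf cj) /saturate.
  by rewrite eva orbT.
pose s : fser := 1 - tser; pose F (m : nat) : fser := s + m%:R * tser.
pose X := \prod_(j | j != c v) F (p j); pose Y := \prod_(j | j != c v) F (q j).
pose Z := \prod_(j | j != c v) F (p j + q j)%N.
pose N1 := #|V1 :\: (v |: U)|; pose N2 := #|V2 :\: (v |: U)|.
have n0 : n = n.-1.+1 by case: (n) (c v) => [[]|].
have setT_id (A : {set 'I_n}) : [set w in A | true] = A by apply/setP => w; rewrite inE andbT.
have cb : #|~: (v |: U)| = (N1 + N2)%N.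
  by have := card_glued1 predT vU; rewrite !setT_id.
have c1 : #|~: (U :|: ~: V1)| = N1.+1.
  by have := card_glued_vertex predT vU v1; rewrite !setT_id addn1.
have c2 : #|~: (U :|: ~: V2)| = N2.+1.
  by have := card_glued_vertex predT vU v2; rewrite !setT_id addn1.
have ca : #|~: U| = (N1 + N2).+1.
  have := card_glued_vertex predT vU (in_setT v).
  by rewrite !setT_id -UT UTv cb addn1.
(* In each class other than that of v, one of p and q is zero, and [F 0] is s. *)
have XY : X * Y = s ^+ n.-1 * Z.
  have -> : s ^+ n.-1 = \prod_(j | j != c v) s.
    by rewrite prodr_const cardC1 card_ord.
  rewrite -!big_split; apply: eq_bigr => j; rewrite eq_sym => /pq[] -> /=; rewrite ?addn0 ?add0n.
    by rewrite /F mul0r addr0.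
  by rewrite /F mul0r addr0 mulrC.
have splitP (f : 'I_n -> fser) : \prod_j f j = f (c v) * \prod_(j | j != c v) f j.
  by rewrite (bigD1 (c v)).
have dv : d (c v) = 1%N by rewrite /d eqxx.
have dj j : j != c v -> d j = 0%N by rewrite /d eq_sym => /negPf ->.
have {}Ha : s ^+ ((N1 + N2).+1 + n) * H (saturate e v) U = F (p (c v) + q (c v)).+1 * Z.
  rewrite -ca Ha splitP fa dv addn1; congr (_ * _).
  by apply: eq_bigr => j /dj jv; rewrite fa jv addn0.
have {}Hb : s ^+ (N1 + N2 + n) * H (saturate e v) (v |: U) = F (p (c v) + q (c v))%N * Z.
  by rewrite -cb Hb splitP fb; congr (_ * _); apply: eq_bigr => j _; rewrite fb.
have {}Hc : s ^+ (N1 + N2 + (n + n)) * H e (v |: U) = F (p (c v)) * X * (F (q (c v)) * Y).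
  rewrite -cb Hc big_split_ord /=; congr (_ * _).
    by rewrite splitP fl; congr (_ * _); apply: eq_bigr => j _; rewrite fl.
  by rewrite splitP fr; congr (_ * _); apply: eq_bigr => j _; rewrite fr.
have {}H1 : s ^+ (N1.+1 + n) * H e (U :|: ~: V1) = F (p (c v)).+1 * X.
  rewrite -c1 H1 splitP f1 dv addn1; congr (_ * _).
  by apply: eq_bigr => j /dj jv; rewrite f1 jv addn0.
have {}H2 : s ^+ (N2.+1 + n) * H e (U :|: ~: V2) = F (q (c v)).+1 * Y.
  rewrite -c2 H2 splitP f2 dv addn1; congr (_ * _).
  by apply: eq_bigr => j /dj jv; rewrite f2 jv addn0.
apply: (@s_lreg (N1 + N2 + (n + n))%N); rewrite -/s /=.
have -> : s ^+ (N1 + N2 + (n + n)) * (s ^+ 2 * (H e (U :|: ~: V1) * H e (U :|: ~: V2))) =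
    (F (p (c v)).+1 * X) * (F (q (c v)).+1 * Y).
  by rewrite -H1 -H2 !exprD !exprS; ring.
have -> : s ^+ (N1 + N2 + (n + n)) *
    (H (saturate e v) U + H e (v |: U) - H (saturate e v) (v |: U)) =
    s ^+ n.-1 * (F (p (c v) + q (c v)).+1 * Z) + F (p (c v)) * X * (F (q (c v)) * Y) -
    s * s ^+ n.-1 * (F (p (c v) + q (c v))%N * Z).
  have sn : s ^+ n = s * s ^+ n.-1 by rewrite -exprS -n0.
  by rewrite -Ha -Hb -Hc !exprD !exprS !exprD !sn; ring.
transitivity ((F (p (c v) + q (c v)).+1 + F (p (c v)) * F (q (c v))
    - s * F (p (c v) + q (c v))%N) * (X * Y)).
  have ZXY a : s ^+ n.-1 * (a * Z) = a * (X * Y) by rewrite XY; ring.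
  by rewrite -[s * _ * _]mulrA !ZXY; ring.
(* With a = p (c v) and b = q (c v), this is F(a+b+1) + F(a) F(b) - s F(a+b) = F(a+1) F(b+1), which
   follows from s + t = 1. *)
by rewrite /F /s -!natr1 natrD; ring.
Qed.

Lemma hser_glue e U : glued e U ->
  hser K e U = (1 - tser) ^+ 2 * (hser K e (U :|: ~: V1) * hser K e (U :|: ~: V2)).
Proof.
apply: (ohtani_ind (A := ~: [set v]) (Inv := glued) (P := glue_identity)).
- exact: glued_closed.
- exact: glue_base.
- exact: glue_step.
Qed.

End Gluing.

(** * Krull dimension *)

Section Growth.
Implicit Types (f g : fser) (d : nat) (Q : {poly int}).

Lemma leq_expl m n d : (m <= n)%N -> (m ^ d <= n ^ d)%N.
Proof. by case: d => // d; rewrite leq_exp2r. Qed.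

(** Growth of order k^d; k + 1 replaces k so that the bound makes sense at k = 0. *)
Definition pbound d f := exists C : nat, forall k, `|f k| <= (C * k.+1 ^ d)%N%:Z.

Lemma pboundD d f g : pbound d f -> pbound d g -> pbound d (f + g).
Proof.
move=> [C fC] [D gD]; exists (C + D)%N => k.
by rewrite fserD mulnDl PoszD (le_trans (ler_normD _ _)) // lerD.
Qed.

Lemma pboundN d f : pbound d f -> pbound d (- f).
Proof. by move=> [C fC]; exists C => k; rewrite fserN normrN. Qed.

Lemma pboundW d e f : (d <= e)%N -> pbound d f -> pbound e f.
Proof.
move=> de [C fC]; exists C => k; apply: le_trans (fC k) _.
by rewrite lez_nat leq_mul2l leq_pexp2l ?orbT.
Qed.

Lemma pbound_t d f : pbound d f -> pbound d (tser * f).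
Proof.
move=> [C fC]; exists C => -[|k]; first by rewrite t_coef0 normr0.
by rewrite t_coefS (le_trans (fC k)) // lez_nat leq_mul2l leq_expl ?orbT.
Qed.

Lemma pbound_geo d f : pbound d f -> pbound d.+1 (geo * f).
Proof.
move=> [C fC]; exists C => k; rewrite geo_coef (le_trans (ler_norm_sum _ _ _)) //.
apply: (@le_trans _ _ (\sum_(i < k.+1) (C * k.+1 ^ d)%N%:Z)).
  apply: ler_sum => i _; apply: le_trans (fC i) _.
  by rewrite lez_nat leq_mul2l leq_expl ?orbT.
by rewrite sumr_const card_ord expnS mulnCA -mulr_natr natz mulrC.
Qed.

Lemma pbound_int (a : int) d f : pbound d f -> pbound d (a%:~R * f).
Proof.
move=> [C fC]; exists (`|a| * C)%N => k.
by rewrite intr_coef normrM -mulnA PoszM abszE ler_wpM2l.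
Qed.

Lemma pbound_poly Q : pbound 0 (geo * toser Q).
Proof.
elim/poly_ind: Q => [|Q a IH].
  by exists 0%N => k; rewrite rmorph0 mulr0 normr0.
rewrite rmorphD rmorphM /= mulrDr; apply: pboundD.
  by rewrite mulrA mulrC; exact: pbound_t.
rewrite toserC mulrC; apply: pbound_int.
by exists 1%N => k; rewrite /geo.
Qed.

Lemma pole_pbound d f Q : (1 - tser) ^+ d * f = toser Q -> pbound d (geo * f).
Proof.
move/s_eq ->; rewrite mulrCA; elim: d => [|d IH]; first by rewrite mul1r; exact: pbound_poly.
by rewrite exprS -mulrA; exact: pbound_geo.
Qed.

Lemma geo_exp_coef d k : (geo ^+ d.+1) k = 'C(k + d, d)%:Z.
Proof.
elim: d k => [|d IHd] k; first by rewrite expr1 bin0.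
elim: k => [|k IHk].
  by rewrite exprS geo_coef big_ord1 IHd !add0n !binn.
rewrite exprS geo_coef big_ord_recr /= -geo_coef -exprS IHk IHd -PoszD.
by rewrite [(k.+1 + d)%N]addSnnS [(k.+1 + d.+1)%N]addSn binS.
Qed.

Lemma geo_exp_ge d k : (k.+1 ^ d <= 'C(k + d, d) * d`!)%N.
Proof.
rewrite bin_ffact; elim: d => [|d IH]; first by rewrite ffactn0.
by rewrite addnS ffactSS expnS leq_mul // ltnS leq_addr.
Qed.

(** Write Q = Q(1) + (1 - t) R. In the partial sums, Q(1)/(1 - t)^(e+1) grows like k^e, while R
    contributes order e - 1 at most. *)
Lemma pole_lower d e f Q : (1 - tser) ^+ e * f = toser Q -> Q.[1] != 0 ->
  pbound d (geo * f) -> (e <= d)%N.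
Proof.
move=> fQ Q1 bd; rewrite leqNgt; apply/negP => lt_de.
case: e lt_de fQ => // e; rewrite ltnS => de fQ.
have [R QE] : exists R, Q = Q.[1]%:P + (1 - 'X) * R.
  have /factor_theorem[R RE] : root (Q - Q.[1]%:P) 1 by rewrite rootE !hornerE subrr.
  exists (- R).
  have -> : (1 - 'X) * - R = R * ('X - 1%:P) by rewrite polyC1; ring.
  by rewrite -RE addrC subrK.
have cE : Q.[1]%:~R * geo ^+ e.+2 = geo * f - geo ^+ e.+1 * toser R :> fser.
  have -> : geo * f = geo ^+ e.+2 * toser Q by rewrite exprS -mulrA -(s_eq fQ).
  rewrite {2}QE rmorphD rmorphM rmorphB rmorph1 /=.
  rewrite toserC mulrDr [geo ^+ e.+2]exprSr; have := geoV; rewrite mulrC => gV.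
  by rewrite -[geo ^+ e.+1 * geo * (_ * toser R)]mulrA [geo * (_ * _)]mulrA gV; ring.
have [C CP] : pbound e (Q.[1]%:~R * geo ^+ e.+2).
  rewrite cE; apply: pboundD; first exact: pboundW bd.
  apply: pboundN; rewrite exprSr -mulrA; elim: e {de fQ cE} => [|e IH].
    by rewrite mul1r; exact: pbound_poly.
  by rewrite exprS -mulrA; exact: pbound_geo.
(* This k breaks the bound: (k+1)^(e+1) would be at most C (e+1)! (k+1)^e = k (k+1)^e. *)
have := CP (C * (e.+1)`!)%N; set k := (C * _)%N.
rewrite intr_coef geo_exp_coef normrM [X in _ * X <= _]ger0_norm // -abszE -PoszM lez_nat => le.
have le1 : ('C(k + e.+1, e.+1) <= C * k.+1 ^ e)%N.
  by apply: leq_trans le; rewrite leq_pmull // absz_gt0.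
have := leq_trans (geo_exp_ge e.+1 k) (leq_mul le1 (leqnn (e.+1)`!)).
by rewrite mulnAC -/k expnS leq_pmul2r ?expn_gt0 // ltnn.
Qed.

(** Factors 1 - t of Q are cancelled until Q(1) != 0 or the exponent is used up; [pole_order]
    settles the second case. *)
Lemma pole_reduce N f Q : (1 - tser) ^+ N * f = toser Q ->
  exists d R, (1 - tser) ^+ d * f = toser R /\ (R.[1] != 0 \/ d = 0%N).
Proof.
elim: N Q => [|N IH] Q fQ; first by exists 0%N, Q; split; [|right].
have [Q1|Q1] := eqVneq Q.[1] 0; last by exists N.+1, Q; split; [|left].
have /factor_theorem[R RE] : root Q 1 by apply/rootP.
apply: (IH (- R)); apply: (@s_lreg 1); rewrite /= mulrA -exprD add1n fQ RE.
have -> : 1 - tser = toser (1 - 'X) by rewrite rmorphB rmorph1.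
by rewrite expr1 -rmorphM; congr toser; rewrite polyC1; ring.
Qed.

End Growth.

(** * Chains of primes and growth *)

Section PrimeChains.
Variables (K : fieldType) (m : nat).
Local Notation S := {mpoly K[m]}.
Implicit Types (I P : S -> Prop).

Definition prime_ideal P := [/\ P 0, ~ P 1, forall a p q, P p -> P q -> P (a * p + q)
  & forall p q, P (p * q) -> P p \/ P q].

(* Only the indices [0, ..., l] of [P] matter. *)
Definition primes_above I l (P : nat -> S -> Prop) :=
  [/\ forall p, I p -> P 0%N p, forall i, (i <= l)%N -> prime_ideal (P i)
    & forall i, (i < l)%N -> (forall p, P i p -> P i.+1 p) /\ exists2 p, P i.+1 p & ~ P i p].

Lemma prime_subspace P : prime_ideal P -> subspace P.
Proof.
by case=> P0 _ PD _; split=> // a u v Pu Pv; rewrite -mul_mpolyC; exact: PD.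
Qed.

Definition indep P (X : finType) (b : X -> S) :=
  forall c : X -> K, P (\sum_x c x *: b x) -> forall x, c x = 0.

Definition mdegle D (p : S) := (msize p <= D.+1)%N.

Lemma mdegleM D E p q : mdegle D p -> mdegle E q -> mdegle (D + E) (p * q).
Proof.
rewrite /mdegle => pD qE.
have [->|p0] := eqVneq p 0; first by rewrite mul0r msize0.
have [->|q0] := eqVneq q 0; first by rewrite mulr0 msize0.
by rewrite msizeM // -subn1 leq_subLR add1n -addSn -addnS leq_add.
Qed.

Lemma mdegleX D p j : mdegle D p -> mdegle (j * D) (p ^+ j).
Proof.
move=> pD; elim: j => [|j IH]; first by rewrite /mdegle expr0 msize1.
by rewrite exprS mulSn; exact: mdegleM.
Qed.

Lemma mdegleW D E p : (D <= E)%N -> mdegle D p -> mdegle E p.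
Proof. by move=> DE pD; apply: leq_trans pD _. Qed.

(** In a relation modulo P, the terms with a positive power of f lie in P', so the coefficients of
    f^0 vanish by independence modulo P'. The rest is divisible by f, which cancels modulo the prime
    P. *)
Lemma indep_powers P P' (X : finType) (b : X -> S) f k :
  prime_ideal P -> (forall p, P p -> P' p) -> subspace P' ->
  (forall a p, P' p -> P' (a * p)) -> P' f -> ~ P f -> indep P' b ->
  indep P (fun jx : 'I_k * X => f ^+ jx.1 * b jx.2).
Proof.
move=> [P0 _ PD PM] PP' sP' P'M P'f nPf ib; elim: k => [|k IH] c; first by move=> _ [[]].
have -> : \sum_jx c jx *: (f ^+ jx.1 * b jx.2) =
    \sum_x c (ord0, x) *: b x + f *
      \sum_(jx : 'I_k * X) c (lift ord0 jx.1, jx.2) *: (f ^+ jx.1 * b jx.2).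
  transitivity (\sum_(j < k.+1) \sum_x c (j, x) *: (f ^+ j * b x)).
    by rewrite pair_bigA; apply: eq_bigr => -[].
  rewrite big_ord_recl; congr (_ + _); first by apply: eq_bigr => x _; rewrite expr0 mul1r.
  rewrite mulr_sumr; under [RHS]eq_bigr do rewrite -scalerAr mulrA -exprS.
  by rewrite pair_bigA.
move=> Pc; have c0 x : c (ord0, x) = 0.
  apply: (ib (fun x => c (ord0, x))); have := PP' _ Pc; set A := \sum_x _; set B := f * _ => P'AB.
  have -> : A = (A + B) - B by rewrite addrK.
  by apply: subspaceB => //; rewrite /B mulrC; exact: P'M.
move: Pc; rewrite big1 ?add0r; last by move=> x _; rewrite c0 scale0r.
case/PM=> [//|/(IH (fun jx => c (lift ord0 jx.1, jx.2))) cl] [j x].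
by case: (unliftP ord0 j) => [j' ->|->]; [exact: (cl (j', x))|exact: c0].
Qed.

(* Choosing [f_i] in [P i.+1] outside [P i], the monomials in [f_0, ..., f_(l-1)]
   are independent modulo [P 0]. *)
Lemma chain_indep I l (P : nat -> S -> Prop) : primes_above I l P ->
  exists E, forall k, exists (X : finType) (b : X -> S),
  [/\ #|X| = (k.+1 ^ l)%N, forall x, mdegle (E * k) (b x) & indep (P 0%N) b].
Proof.
elim: l I P => [|l IH] I P [IP pP sP].
  exists 0%N => k; exists unit, (fun=> 1); rewrite card_unit; split=> // [x|c].
    by rewrite /mdegle msize1.
  rewrite (bigD1 tt) //= big1 ?addr0; last by case.
  move=> Pc [] /=; apply/eqP.
  have [P0 P1 PD _] := pP 0%N isT; apply: contra_notT P1 => c0.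
  rewrite -[1](scale1r (1 : S)) -(mulVf c0) -scalerA; apply: subspaceZ => //.
  exact/prime_subspace/pP.
have [E HE] : exists E, forall k, exists (X : finType) (b : X -> S),
    [/\ #|X| = (k.+1 ^ l)%N, forall x, mdegle (E * k) (b x) & indep (P 1%N) b].
  by apply: (IH (P 1%N) (fun i => P i.+1)); split=> // i il; [exact: pP|exact: sP].
have [sP01 [f P1f nP0f]] := sP 0%N isT.
exists (msize f + E)%N => k; have [X [b [cX dX iX]]] := HE k.
exists ('I_k.+1 * X)%type, (fun jx : 'I_k.+1 * X => f ^+ jx.1 * b jx.2); split.
- by rewrite card_prod card_ord cX expnS.
- move=> [j x] /=; rewrite mulnDl; apply: mdegleM => //.
  apply: (mdegleW (D := (j * msize f)%N)); last by apply: mdegleX; exact: leqnSn.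
  by rewrite mulnC leq_mul2l -ltnS ltn_ord orbT.
- have p1 := pP 1%N isT; have p0 := pP 0%N isT.
  apply: (indep_powers (P' := P 1%N)) => //; first exact: prime_subspace.
  by case: p1 => P10 _ PD _ a p Pp; rewrite -[_ * _]addr0; exact: PD.
Qed.

Lemma span_degree I D : subspace I ->
  exists b : 'I_(\sum_(j < D) hilb I j) -> S, forall p, (msize p <= D)%N -> span_mod I b p.
Proof.
move=> sI; suff [b bP] : exists b : 'I_(\sum_(j < D) hilb I j) -> S,
    forall p : nat -> S, (forall j, degpart j (p j)) -> span_mod I b (\sum_(j < D) p j).
  exists b => p pD; rewrite (pihomog_partitionE (mf := mdeg) pD).
  by apply: (bP (fun j => pihomog mdeg j p)) => j; exact: pihomogP.
elim: D => [|D [b bP]].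
  rewrite big_ord0; exists (fun=> 0) => p _; exists (fun=> 0).
  by rewrite !big_ord0 subrr; exact: subspace0.
rewrite big_ord_recr /=; have [b' [_ _ sb']] := hilbP D sI.
exists (fun i => match split i with inl j => b j | inr j => b' j end) => p hp.
have [c Wc] := bP p hp; have [c' Wc'] := sb' (p D) (hp D).
exists (fun i => match split i with inl j => c j | inr j => c' j end).
rewrite big_split_ord big_ord_recr /= opprD addrACA; apply: subspaceD => //.
  by move: Wc; congr (I (_ - _)); apply: eq_bigr => j _; rewrite (unsplitK (inl j)).
by move: Wc'; congr (I (_ - _)); apply: eq_bigr => j _; rewrite (unsplitK (inr j)).
Qed.

(** The (k+1)^l independent elements of [chain_indep] have degree at most E k, where the dimension
    modulo I is at most C (E k + 1)^d. *)
Lemma chain_le I l (P : nat -> S -> Prop) d : subspace I -> primes_above I l P ->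
  pbound d (geo * hilbser I) -> (l <= d)%N.
Proof.
move=> sI cP [C bC]; have [E HE] := chain_indep cP; have [IP _ _] := cP.
have count k : (k.+1 ^ l <= C * (E * k).+1 ^ d)%N.
  have [X [b [cX dX iX]]] := HE k; have [b' b'P] := span_degree (E * k).+1 sI.
  rewrite -cX; apply: leq_trans (_ : \sum_(j < (E * k).+1) hilb I j <= _)%N; last first.
    have := bC (E * k)%N; rewrite geo_coef.
    have -> : \sum_(i < (E * k).+1) hilbser I i = (\sum_(i < (E * k).+1) hilb I i)%N%:Z.
      by rewrite (big_morph Posz PoszD (erefl (0 : int))).
    by rewrite ger0_norm.
  apply: (steinitz (W := I) sI (u := fun i : 'I_#|X| => b (enum_val i)) (b := b')).
    move=> c Ic i; rewrite -(enum_valK i); set x := enum_val i.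
    apply: (iX (fun x => c (enum_rank x))); apply: IP; move: Ic; congr I.
    rewrite [RHS](reindex (@enum_val X predT)) /=; last exact/onW_bij/enum_val_bij.
    by apply: eq_bigr => j _; rewrite enum_valK.
  by move=> i; apply: b'P; exact: dX.
(* For this k, C (E k + 1)^d <= C (E+1)^d (k+1)^d = k (k+1)^d < (k+1)^(d+1), against [count]. *)
rewrite leqNgt; apply/negP => lt_dl; pose k := (C * E.+1 ^ d)%N.
have := count k; rewrite leqNgt => /negP; apply.
apply: (@leq_ltn_trans (k * k.+1 ^ d)).
  rewrite /k -mulnA leq_mul2l -expnMn leq_expl ?orbT // -/k.
  by rewrite mulSn mulnS; lia.
apply: (@leq_trans (k.+1 ^ d.+1)); last by rewrite leq_pexp2l.
by rewrite expnS ltn_pmul2r ?expn_gt0.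
Qed.

End PrimeChains.

Section KillVariables.
Variables (K : fieldType) (N : nat).
Local Notation T := {mpoly K[N]}.

Definition kill_vars (Z : seq 'I_N) : T -> T := subst (fun t => if t \in Z then 0 else 'X_t).

HB.instance Definition _ Z := GRing.RMorphism.on (kill_vars Z).

Lemma kill_varsX Z t : kill_vars Z 'X_t = if t \in Z then 0 else 'X_t.
Proof. exact: substX. Qed.

Lemma kill_vars_comp Z Z' p : {subset Z <= Z'} -> kill_vars Z' (kill_vars Z p) = kill_vars Z' p.
Proof.
move=> ZZ'; rewrite /kill_vars subst_comp; apply: eq_subst => t /=.
by case: ifP => [/ZZ' ->|_]; rewrite ?rmorph0 ?substX.
Qed.

End KillVariables.

Section ClusterChain.
Variables (K : fieldType) (n q : nat) (c : 'I_n -> 'I_q) (e : rel 'I_n) (U : {set 'I_n}).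
Local Notation S := {mpoly K[n + n]}.
Hypothesis cl : clustered c e U.

Let classes := c @: ~: U.

(* Variables of the toric ring in the order in which they are set to zero:
   those of the cliques come before those of the vertices, so that each step
   enlarges the kernel. *)
Let killed : seq 'I_(q + n) :=
  [seq lshift n j | j <- enum classes] ++ [seq rshift q w | w <- enum (~: U)].

Let killed_uniq : uniq killed.
Proof.
rewrite cat_uniq !map_inj_uniq ?enum_uniq ?andbT /=; [|exact: rshift_inj|exact: lshift_inj].
by apply/hasPn => _ /mapP[w _ ->]; apply/negP => /mapP[j _ /eqP]; rewrite eq_rlshift.
Qed.

(** The i-th ideal is the kernel of [toric] followed by killing i variables, prime because the
    target is a domain. Strictness is witnessed by x_w when a clique variable is killed and by y_w
    when a vertex variable is. *)
Lemma cluster_chain : exists P : nat -> S -> Prop,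
  primes_above (J e U) (#|classes| + #|~: U|) P.
Proof.
have size_killed : size killed = (#|classes| + #|~: U|)%N.
  by rewrite size_cat !size_map !cardE.
exists (fun i p => kill_vars (take i killed) (toric c U p) = 0); split.
- by move=> p /(toric_J cl) ->; rewrite rmorph0.
- move=> i _; split.
  + by rewrite !rmorph0.
  + by rewrite !rmorph1; exact/eqP/oner_neq0.
  + by move=> a p r p0 r0; rewrite !rmorphD !rmorphM /= p0 r0 mulr0 addr0.
  + by move=> p r; rewrite !rmorphM /= => /eqP; rewrite mulf_eq0 => /orP[]/eqP; [left|right].
rewrite -size_killed => i lt_i; pose t := tnth (in_tuple killed) (Ordinal lt_i).
have take_t : take i.+1 killed = rcons (take i killed) t.
  by rewrite (take_nth t) // {2}/t (tnth_nth t).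
split.
  move=> p p0; rewrite -(@kill_vars_comp _ _ (take i killed)) ?p0 ?rmorph0 // => t'.
  by rewrite take_t mem_rcons inE => ->; rewrite orbT.
have tN : t \notin take i killed.
  have := take_uniq i.+1 killed_uniq; rewrite take_t rcons_uniq => /andP[] //.
have X0 s : ('X_s : {mpoly K[q + n]}) != 0.
  by rewrite -msize_poly_eq0 msizeX mdeg1.
have : t \in killed by exact: mem_tnth.
rewrite mem_cat => /orP[] /mapP[].
  move=> j; rewrite mem_enum => /imsetP[w wU ->] tE; exists (xv K w).
    rewrite toric_xv; move: wU; rewrite inE => /negPf ->.
    by rewrite rmorphM /= !kill_varsX take_t !mem_rcons !inE tE eqxx /= mulr0.
  have wU' : w \in U = false by move: wU; rewrite inE => /negPf.
  rewrite toric_xv wU' rmorphM /= !kill_varsX -tE (negPf tN); case: ifP => [wi _|_]; last first.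
    by apply/eqP; rewrite mulf_neq0.
  have lt_i' : (i < #|classes|)%N.
    rewrite ltnNge; apply/negP => le_i; move: tN; rewrite take_cat size_map -cardE ltnNge le_i /=.
    by rewrite mem_cat tE map_f // mem_enum imset_f.
  move: wi; rewrite take_cat size_map -cardE lt_i' => /mem_take /mapP[j' _ /eqP].
  by rewrite eq_rlshift.
move=> w; rewrite mem_enum inE => /negPf wU tE; exists (yv K w).
  by rewrite toric_yv wU kill_varsX take_t mem_rcons inE tE eqxx.
by rewrite toric_yv wU kill_varsX -tE (negPf tN); exact/eqP.
Qed.

(** The empty classes are cancelled from [hser_cluster], so that the exponent equals the length of
    the chain. *)
Lemma cluster_pole : exists Q,
  (1 - tser) ^+ (#|classes| + #|~: U|) * hser K e U = toser Q.
Proof.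
pose Q : {poly int} := \prod_(j in classes) ((1 - 'X) + #|[set w in ~: U | c w == j]|%:R * 'X).
exists Q; apply: (@s_lreg (q - #|classes|)); rewrite /= mulrA -exprD addnA subnK; last first.
  by rewrite -[X in (_ <= X)%N](card_ord q) max_card.
rewrite addnC (hser_cluster K cl) (bigID (mem classes)) /= mulrC; congr (_ * _).
  transitivity (\prod_(j in predC (mem classes)) (1 - tser)); last first.
    rewrite prodr_const; congr (_ ^+ _).
    by rewrite -[X in (X - _)%N](card_ord q) -(cardC (mem classes)) addKn.
  apply: eq_bigr => j jN; rewrite [X in X%:R]eq_card0 ?mul0r ?addr0 // => w.
  rewrite !inE; apply/negP => /andP[wU /eqP cw]; case/negP: jN.
  by rewrite -cw imset_f // inE.
rewrite rmorph_prod; apply: eq_bigr => j _.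
by rewrite rmorphD rmorphB rmorphM rmorph1 rmorph_nat.
Qed.

End ClusterChain.

Section Dimension.
Variables (K : fieldType) (n : nat).
Local Notation S := {mpoly K[n + n]}.
Implicit Types (e : rel 'I_n) (U : {set 'I_n}).

Lemma hser_rational e U : ssrbool.symmetric e ->
  exists N Q, (1 - tser) ^+ N * hser K e U = toser Q.
Proof.
apply: (ohtani_ind (A := setT) (Inv := fun e _ => ssrbool.symmetric e)
  (P := fun e U => exists N Q, (1 - tser) ^+ N * hser K e U = toser Q)) => {e U}.
- by move=> e U u es _ _; split=> //; exact: saturate_sym.
- move=> e U es sp; have [c cl] := simplicial_clustered es (fun u => sp u (in_setT u)).
  by have [Q HQ] := cluster_pole K cl; exists (#|c @: ~: U| + #|~: U|)%N, Q.
- move=> e U u _ _ _ [N1 [Q1 H1]] [N2 [Q2 H2]] [N3 [Q3 H3]].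
  exists (N1 + (N2 + N3))%N, ((1 - 'X) ^+ (N2 + N3) * Q1 + (1 - 'X) ^+ (N1 + N3) * Q2
    - (1 - 'X) ^+ (N1 + N2) * Q3).
  rewrite (hser_ohtani K e U u) rmorphB rmorphD !rmorphM !rmorphXn !rmorphB !rmorph1 /=.
  by rewrite -H1 -H2 -H3 !exprD; ring.
Qed.

(** Lower and upper bound for the dimension, carried through the induction with the same d. *)
Definition chain_pole (I : S -> Prop) d :=
  (exists P, primes_above I d P) /\ pbound d (geo * hilbser I).

(** [J e U] lies in both ideals of the intersection, so a chain above either one is above it; its
    Hilbert function is at most the sum of theirs, the remaining term of [hilb_ohtani] being
    nonnegative. Hence the maximum of the two exponents works. *)
Lemma ex_chain_pole e U : ssrbool.symmetric e -> exists d, chain_pole (J e U) d.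
Proof.
apply: (ohtani_ind (A := setT) (Inv := fun e _ => ssrbool.symmetric e)
  (P := fun e U => exists d, chain_pole (J e U) d)) => {e U}.
- by move=> e U u es _ _; split=> //; exact: saturate_sym.
- move=> e U es sp; have [c cl] := simplicial_clustered es (fun u => sp u (in_setT u)).
  exists (#|c @: ~: U| + #|~: U|)%N; split; first exact: cluster_chain.
  by have [Q] := cluster_pole K cl; exact: pole_pbound.
- move=> e U u _ _ _ [d1 [[P1 [IP1 pP1 sP1]] b1]] [d2 [[P2 [IP2 pP2 sP2]] b2]] _.
  exists (maxn d1 d2); split.
    case: leqP => _.
      by exists P2; split=> // p Jp; apply: IP2; have [] := (ohtani_inter e U u p).1 Jp.
    by exists P1; split=> // p Jp; apply: IP1; have [] := (ohtani_inter e U u p).1 Jp.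
  have [C HC] : pbound (maxn d1 d2) (geo * hilbser (J (K := K) (saturate e u) U) +
      geo * hilbser (J (K := K) e (u |: U))).
    apply: pboundD; [apply: pboundW b1|apply: pboundW b2]; first exact: leq_maxl.
    exact: leq_maxr.
  exists C => k; apply: le_trans (HC k); rewrite fserD !geo_coef -big_split /= !ger0_norm.
  + by apply: ler_sum => j _; have := hilb_ohtani K e U u j; rewrite /hilbser; lia.
  + by apply: sumr_ge0 => j _; rewrite /hilbser; lia.
  + by apply: sumr_ge0 => j _; rewrite /hilbser; lia.
Qed.

End Dimension.

Section PoleOrder.
Variables (K : fieldType) (m : nat) (I : {mpoly K[m]} -> Prop).

(* The Krull dimension is the order of the pole at [t = 1] of the Hilbert
   series; both bounds compare with the growth of its partial sums. *)
Lemma pole_order d P N Q : subspace I -> primes_above I d P ->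
  pbound d (geo * hilbser I) -> (1 - tser) ^+ N * hilbser I = toser Q ->
  exists R, (1 - tser) ^+ d * hilbser I = toser R /\ R.[1] != 0.
Proof.
move=> sI cP bd HQ; have [d' [R [HR R1]]] := pole_reduce HQ.
have dd' : (d <= d')%N by apply: (chain_le sI cP); exact: pole_pbound HR.
have {}dd' : d = d'.
  apply/eqP; rewrite eqn_leq dd'; case: R1 => [R1|->//].
  exact: pole_lower HR R1 bd.
rewrite -{}dd' in HR R1; exists R; split=> //; case: R1 => [//|d0].
(* For d = 0 the series is R itself, with nonnegative coefficients and positive constant term, so
   R(1) > 0. *)
rewrite d0 mul1r in HR.
have RE k : R`_k = (hilb I k)%:Z by rewrite -[RHS]/(hilbser I k) HR.
have h0 : (0 < hilb I 0)%N.
  rewrite lt0n; apply/eqP => h0; have := hilbP 0 sI; rewrite h0 => -[b [_ _ /(_ 1)]].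
  case; first exact: dhomog1.
  move=> c; rewrite big_ord0 subr0 => I1; have [IP pP _] := cP.
  by have [_ nP1 _ _] := pP 0%N isT; exact/nP1/IP.
have sR : (0 < size R)%N.
  by rewrite lt0n size_poly_eq0; apply/eqP => R0; move: (RE 0%N); rewrite R0 coef0; lia.
rewrite horner_coef; apply/lt0r_neq0.
move: sR; case: (size R) => // s _; rewrite big_ord_recl expr0 mulr1 RE.
apply: ltr_wpDr; last by rewrite ltz_nat.
by apply: sumr_ge0 => i _; rewrite expr1n mulr1 RE.
Qed.

End PoleOrder.

(** * Passage to the quotient rings of the graphs *)
Local Open Scope quotient_scope.

Lemma ideal_gen_gideal (R : comNzRingType) (s : seq R) p :
  p \in ideal_gen s <-> gideal (fun g => g \in s) p.
Proof.
split=> [/ideal_genP[c ->]|].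
  by apply: gideal_sum => i _; apply: gidealM; apply: gideal_gen; exact: mem_nth.
elim=> [|a g q gs _ /ideal_genP[c ->]]; apply/ideal_genP.
  by exists (fun=> 0); rewrite big1 // => i _; rewrite mul0r.
have lt_g : (index g s < size s)%N by rewrite index_mem.
exists (fun i => (i == Ordinal lt_g)%:R * a + c i).
under [RHS]eq_bigr do rewrite mulrDl; rewrite big_split /=; congr (_ + _).
rewrite (bigD1 (Ordinal lt_g)) //= eqxx mul1r nth_index // big1 ?addr0 // => i /negPf ->.
by rewrite !mul0r.
Qed.

Section PrimeOfPred.
Variable R : comNzRingType.

(** The closure proofs are arguments so that structures can be attached to an arbitrary
    predicate. *)
Definition prime_of (S : {pred R}) of idealr_closed S & prime_idealr_closed S : {pred R} :=
  S.

HB.instance Definition _ S (hS : idealr_closed S) (pS : prime_idealr_closed S) :=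
  isIdealr.Build R (prime_of hS pS) hS.
HB.instance Definition _ S (hS : idealr_closed S) (pS : prime_idealr_closed S) :=
  isPrimeIdealrClosed.Build R (prime_of hS pS) pS.

Lemma ex_prime_idealr (S : {pred R}) : idealr_closed S -> prime_idealr_closed S ->
  exists P : prime_idealr R, P =i S.
Proof. by move=> hS pS; exists (prime_of hS pS). Qed.

End PrimeOfPred.

Section Quotient.
Variables (K : fieldType) (m : nat) (I : idealr {mpoly K[m]}).
Local Notation S := {mpoly K[m]}.
Local Notation A := {ideal_quot I}.
Implicit Types (p : S) (a : A).

Lemma pi_eq0 p : (\pi_A p = 0) <-> (p \in I).
Proof.
have -> : (p \in I) = (\pi_A p == \pi_A 0) by rewrite -Quotient.idealrBE subr0.
by rewrite raddf0; split=> [->|/eqP].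
Qed.

Lemma pi_sum (d : nat) (c : 'I_d -> K) (b : 'I_d -> S) :
  \pi_A (\sum_i c i *: b i) = \sum_i c i *: \pi_A (b i).
Proof. by rewrite raddf_sum; apply: eq_bigr => i _; exact: pi_scale. Qed.

Lemma hilbert_fun_qdim k : qdim (degpart k) (fun p => p \in I) (hilbert_fun I k).
Proof.
have [b [gb fb sb]] := hilbert_funP I k.
have /choice[p pP] : forall i, exists p, p \is k.-homog /\ b i = \pi_A p.
  by move=> i; have [p hp ->] := gb i; exists p.
have piE c : \pi_A (\sum_i c i *: p i) = \sum_i c i *: b i.
  by rewrite pi_sum; apply: eq_bigr => i _; rewrite (pP i).2.
exists p; split=> [i|c /pi_eq0|u hu]; first by case: (pP i).
- by rewrite piE; exact: fb.
- have [|c cE] := sb (\pi_A u); first by exists u.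
  by exists c; apply/pi_eq0; rewrite raddfB /= piE cE subrr.
Qed.

Lemma prime_quot (P : S -> Prop) : (forall p, p \in I -> P p) -> prime_ideal P ->
  exists Q : prime_idealr A, forall p, (\pi_A p \in Q) <-> P p.
Proof.
move=> IP [P0 P1 PD PM].
pose Q : {pred A} := fun a => `[< exists2 p, P p & a = \pi_A p >].
have QP p : (\pi_A p \in Q) <-> P p.
  split=> [/asboolP[q Pq /eqP]|Pp]; last by apply/asboolP; exists p.
  rewrite -subr_eq0 -raddfB => /eqP /pi_eq0 /IP Ppq.
  by rewrite -(subrK q p) -[_ - _]mul1r; exact: PD.
have [|u v|Q' Q'Q] := @ex_prime_idealr A Q; last by exists Q' => p; rewrite Q'Q.
  split; first by rewrite -(raddf0 (\pi_A)) QP.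
    by rewrite -(rmorph1 (\pi_A)); apply/negP => /QP.
  move=> a u v; rewrite -[a]reprK -[u]reprK -[v]reprK -rmorphM -rmorphD.
  by move=> /QP Pu /QP Pv; apply/QP; exact: PD.
rewrite -[u]reprK -[v]reprK -rmorphM => /QP /PM[] /QP -> //.
by rewrite orbT.
Qed.

(** Correspondence of primes of the quotient with primes above I. Strictness of consecutive steps
    becomes strictness for every pair of indices through [Pmono]. *)
Lemma krull_dimP d : (exists P, primes_above (fun p => p \in I) d P) ->
  (forall l P, primes_above (fun p => p \in I) l P -> (l <= d)%N) ->
  is_krull_dim A d.
Proof.
move=> [P [IP pP sP]] maxd.
have Pmono i j : (i <= j <= d)%N -> forall p, P i p -> P j p.
  case/andP=> /subnK <-; elim: (j - i)%N => [|k IH] // le_kd p Pp.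
  have [sub _] := sP (k + i)%N le_kd.
  by apply: sub; apply: IH => //; exact: ltnW.
split.
  have /choice[Q QP] : forall i : 'I_d.+1, exists Q : prime_idealr A,
      forall p, (\pi_A p \in Q) <-> P i p.
    move=> i; have le_id : (i <= d)%N by rewrite -ltnS.
    apply: prime_quot; last exact: pP.
    by move=> p /IP; apply: Pmono.
  exists Q => i j lt_ij; have le_jd : (j <= d)%N by rewrite -ltnS.
  split.
    move=> a; rewrite -[a]reprK => /QP Pa; apply/QP.
    by apply: Pmono Pa; rewrite (ltnW lt_ij).
  move=> sub; have [_ [p Pp]] := sP i (leq_trans lt_ij le_jd); apply.
  by apply/QP/sub/QP; apply: Pmono Pp; rewrite lt_ij.
move=> l Q cQ; apply: (maxd l (fun i p => \pi_A p \in Q (inord i))); split.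
- by move=> p /pi_eq0 ->; exact: rpred0.
- move=> i _; split; first by rewrite raddf0 rpred0.
  + by rewrite rmorph1 idealr1.
  + move=> a p q Pp Pq; rewrite rmorphD rmorphM; apply: rpredD => //.
    exact: idealMr.
  + by move=> p q; rewrite rmorphM prime_idealrM => /orP.
- move=> i lt_il; have [|sub nsub] := cQ (inord i) (inord i.+1).
    by rewrite !inordK // ltnS ltnW.
  split=> [p|]; first exact: sub.
  apply: contrapT => no; apply: nsub => a; rewrite -[a]reprK => Pa.
  by apply: contrapT => nPa; apply: no; exists (repr a).
Qed.

End Quotient.

Section GraphRing.
Variables (K : fieldType) (n : nat) (G : sgraph n).
Local Notation N := #|vset G|.
Local Notation S := {mpoly K[N + N]}.
Local Notation S0 := {mpoly K[n + n]}.

Definition vadj : rel 'I_N := fun k l => adj G (enum_val k) (enum_val l).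

Lemma vadj_sym : ssrbool.symmetric vadj.
Proof. by move=> k l; exact: adj_sym. Qed.

(** In [J vadj set0] each edge gives a generator for either orientation; the two differ by a sign,
    and there are no loops. *)
Lemma beiE (p : S) : p \in 'J_(K, G) <-> J vadj set0 p.
Proof.
rewrite -[p \in _]/(p \in ideal_gen (bei_gens K G)).
have genP q : q \in bei_gens K G <-> exists k l : 'I_N,
    [/\ ((enum_val k : 'I_n) < (enum_val l : 'I_n))%N,
        adj G (enum_val k) (enum_val l) & q = edge_poly K k l].
  split=> [/mapP[[k l]]|[k [l [lt_kl ekl ->]]]].
    by rewrite mem_enum inE /= => /andP[lt_kl ekl] ->; exists k, l.
  by apply/mapP; exists (k, l); rewrite // mem_enum inE /= lt_kl.
rewrite ideal_gen_gideal; split; apply: gideal_sub => q.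
  by move/genP => [k [l [_ ekl ->]]]; exact: J_edge.
case=> [k l ekl|u|u]; rewrite ?in_set0 //.
have [lt_kl|lt_lk|/val_inj/enum_val_inj E] := ltngtP (enum_val k : 'I_n) (enum_val l : 'I_n).
- by apply/gideal_gen/genP; exists k, l.
- have -> : edge_poly K k l = - 1 * edge_poly K l k by rewrite /edge_poly; ring.
  by apply/gidealM/gideal_gen/genP; exists l, k; rewrite (adj_sym G).
- by move: ekl; rewrite E /vadj adj_irr.
Qed.

(** With [of_full], an isomorphism modulo the ideals: the ideal of G in its own ring corresponds to
    that of G plus all variables outside [vset G] in the ring on n vertices. *)
Definition to_full : S -> S0 := subst (fun i => match split i with
  inl k => xv K (enum_val k) | inr k => yv K (enum_val k) end).

Definition vindex (w : 'I_n) : option 'I_N := [pick k | enum_val k == w].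

Definition of_full : S0 -> S := subst (fun i => match split i with
  | inl w => oapp (@xv K N) 0 (vindex w) | inr w => oapp (@yv K N) 0 (vindex w) end).

HB.instance Definition _ := GRing.RMorphism.on to_full.
HB.instance Definition _ := GRing.RMorphism.on of_full.

Lemma vindexK k : vindex (enum_val k) = Some k.
Proof.
rewrite /vindex; case: pickP => [l /eqP /enum_val_inj -> //|/(_ k)].
by rewrite eqxx.
Qed.

Lemma vindex_in w : w \in vset G -> exists2 k, vindex w = Some k & enum_val k = w.
Proof.
move=> wG; exists (enum_rank_in wG w); rewrite ?enum_rankK_in //.
by rewrite -{1}(enum_rankK_in wG wG) vindexK.
Qed.

Lemma vindex_out w : w \notin vset G -> vindex w = None.
Proof.
rewrite /vindex; case: pickP => // k /eqP <-.
by rewrite enum_valP.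
Qed.

Lemma to_full_x k : to_full (xv K k) = xv K (enum_val k).
Proof. by rewrite /to_full substX (unsplitK (inl k)). Qed.
Lemma to_full_y k : to_full (yv K k) = yv K (enum_val k).
Proof. by rewrite /to_full substX (unsplitK (inr k)). Qed.
Lemma of_full_x w : of_full (xv K w) = oapp (@xv K N) 0 (vindex w).
Proof. by rewrite /of_full substX (unsplitK (inl w)). Qed.
Lemma of_full_y w : of_full (yv K w) = oapp (@yv K N) 0 (vindex w).
Proof. by rewrite /of_full substX (unsplitK (inr w)). Qed.

Lemma to_fullK p : of_full (to_full p) = p.
Proof.
rewrite /of_full /to_full subst_comp -[RHS]subst_id; apply: eq_subst => i /=.
rewrite -/(of_full _); case: (split i) (splitK i) => k <-.
  by rewrite of_full_x vindexK.
by rewrite of_full_y vindexK.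
Qed.

Lemma to_full_J p : J vadj set0 p -> J (adj G) (~: vset G) (to_full p).
Proof.
apply: gideal_morph => q [k l ekl|u|u]; rewrite ?in_set0 //=.
by rewrite /edge_poly rmorphB !rmorphM /= !to_full_x !to_full_y; exact: J_edge.
Qed.

Lemma of_full_J p : J (adj G) (~: vset G) p -> J vadj set0 (of_full p).
Proof.
apply: gideal_morph => q [i j eij|u|u]; rewrite ?inE /=.
- rewrite /edge_poly rmorphB !rmorphM /= !of_full_x !of_full_y.
  have /andP[/vindex_in[k -> kE] /vindex_in[l -> lE]] := adj_vset eij.
  by apply: J_edge; rewrite /vadj kE lE.
- by move=> /vindex_out uG; rewrite of_full_x uG; exact: gideal0.
- by move=> /vindex_out uG; rewrite of_full_y uG; exact: gideal0.
Qed.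

Lemma of_fullK p : J (adj G) (~: vset G) (p - to_full (of_full p)).
Proof.
rewrite /to_full /of_full subst_comp -[X in X - _]subst_id; apply: subst_cong => i /=.
rewrite -/(to_full _); case: (split i) (splitK i) => w <- /=.
  have [/vindex_in[k -> kE]|wG] := boolP (w \in vset G).
    by rewrite /= to_full_x kE subrr; exact: gideal0.
  by rewrite vindex_out //= rmorph0 subr0; apply/gideal_gen/egen_x; rewrite inE.
have [/vindex_in[k -> kE]|wG] := boolP (w \in vset G).
  by rewrite /= to_full_y kE subrr; exact: gideal0.
by rewrite vindex_out //= rmorph0 subr0; apply/gideal_gen/egen_y; rewrite inE.
Qed.

Lemma hilb_full k : hilb (J (K := K) (adj G) (~: vset G)) k = hilb (J (K := K) vadj set0) k.
Proof.
apply: hilb_eq; first exact: J_subspace.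
have [b [hb fb sb]] := hilbP k (J_subspace K vadj set0).
have toE c : to_full (\sum_i c i *: b i) = \sum_i c i *: to_full (b i).
  by rewrite rmorph_sum; apply: eq_bigr => i _; exact: substZ.
exists (fun i => to_full (b i)); split=> [i|c|u hu].
- apply: subst_homog (hb i) => t; case: (split t) => s; by rewrite dhomogX /= mdeg1.
- by rewrite -toE => /of_full_J; rewrite to_fullK; exact: fb.
- have [|c Jc] := sb (of_full u).
    apply: subst_homog hu => t; case: (split t) => s; case: (vindex s) => [r|] /=;
      by rewrite ?dhomog0 // dhomogX /= mdeg1.
  exists c; rewrite -toE -(subrK (to_full (of_full u)) u) -addrA -rmorphB.
  by apply: gidealD; [exact: of_fullK|exact: to_full_J].
Qed.

Lemma hilbert_seriesE : hilbert_series 'J_(K, G) = hser K (adj G) (~: vset G).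
Proof.
apply/funext => k; rewrite /hilbert_series /hser /hilbser hilb_full; congr Posz.
apply/esym/hilb_eq; first exact: J_subspace.
by apply: qdim_ext (hilbert_fun_qdim 'J_(K, G) k) => // p; exact: beiE.
Qed.

Lemma bei_krull : exists d Q, [/\ is_krull_dim {ideal_quot 'J_(K, G)} d,
  (1 - tser) ^+ d * (hilbert_series 'J_(K, G) : fser) = toser Q & Q.[1] != 0].
Proof.
have [d [[P cP] bd]] := ex_chain_pole K set0 vadj_sym.
have [N0 [Q0 HQ0]] := hser_rational K set0 vadj_sym.
have sJ := J_subspace K vadj set0.
have [Q [HQ Q1]] := pole_order sJ cP bd HQ0.
have hE : hilbert_series 'J_(K, G) = hilbser (J (K := K) vadj set0).
  rewrite hilbert_seriesE; apply/funext => k; rewrite /hser /hilbser.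
  by congr Posz; exact: hilb_full.
exists d, Q; rewrite hE; split=> //; apply: krull_dimP.
  by exists P; case: cP => IP pP sP; split=> // p /beiE; exact: IP.
move=> l P' [IP pP sP]; apply: (chain_le (P := P') sJ) bd.
by split=> // p Jp; apply: IP; exact/beiE.
Qed.

End GraphRing.

(** * Reading off dimension and multiplicity *)

(** Both exponents are the order of vanishing at 1 of one polynomial. *)
Lemma s_valuation a b (Q R : {poly int}) : Q.[1] != 0 -> R.[1] != 0 ->
  (1 - 'X) ^+ a * Q = (1 - 'X) ^+ b * R -> a = b /\ Q = R.
Proof.
have X1 : (1 - 'X : {poly int}) != 0.
  by apply/eqP => /(congr1 (horner^~ 0)); rewrite !hornerE.
wlog le_ab : a b Q R / (a <= b)%N => [H|] Q1 R1 E.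
  have [/H|/ltnW/H] := leqP a b; first exact.
  by move=> /(_ R Q R1 Q1 (esym E))[-> ->].
move: E; rewrite -(subnK le_ab) exprD [(1 - 'X) ^+ (b - a) * _]mulrC -mulrA.
move/(mulfI (expf_neq0 _ X1)); case: (b - a)%N => [|k] QE; first by rewrite QE mul1r.
have s1 : (1 - 'X : {poly int}).[1] = 0 by rewrite !hornerE.
by move: Q1; rewrite QE exprS -mulrA hornerM s1 mul0r eqxx.
Qed.

(** Each edge at v extends to a maximal clique containing v; as there is only one, it contains all
    neighbours of v. *)
Lemma free_vertex_simplicial n (G : sgraph n) v i j : free_vertex G v ->
  i != j -> adj G v i -> adj G v j -> adj G i j.
Proof.
move=> /cards1P[C0 C0E] ij evi evj.
have inC0 k : adj G v k -> k \in C0.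
  move=> evk; have clq : clique G [set v; k].
    apply/andP; split.
      by apply/subsetP => w; rewrite !inE => /orP[]/eqP ->; have /andP[] := adj_vset evk.
    apply/forall_inP => a; rewrite !inE => /orP[]/eqP ->;
      apply/forall_inP => b; rewrite !inE => /orP[]/eqP ->; rewrite ?eqxx ?evk ?implybT //.
    by rewrite adj_sym evk implybT.
  have [C mC sC] := maxset_exists clq.
  have : C \in [set C0].
    by rewrite -C0E inE mC (subsetP sC) // !inE eqxx.
  by move/set1P => <-; rewrite (subsetP sC) // !inE eqxx orbT.
have : C0 \in [set C0] by rewrite inE.
rewrite -C0E inE => /andP[/maxsetp /andP[_ /forall_inP cC0] _].
by have /forall_inP/(_ j (inC0 _ evj)) := cC0 i (inC0 _ evi); rewrite ij.
Qed.

Theorem theorem3p2 (K : fieldType) (n : nat) (G G1 G2 : sgraph n) (v : 'I_n) :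
  vset G = [set: 'I_n] ->
  is_union G G1 G2 ->
  induced_subgraph G1 G ->
  induced_subgraph G2 G ->
  vset G1 :&: vset G2 = [set v] ->
  free_vertex G1 v ->
  free_vertex G2 v ->
  [/\ hilbert_series 'J_(K, G) =
        fps_mul (fps_of_poly ((1 - 'X) ^+ 2))
          (fps_mul (hilbert_series 'J_(K, G1)) (hilbert_series 'J_(K, G2))),
      exists d d1 d2 : nat,
        [/\ is_krull_dim {ideal_quot 'J_(K, G)} d,
            is_krull_dim {ideal_quot 'J_(K, G1)} d1,
            is_krull_dim {ideal_quot 'J_(K, G2)} d2
          & d%:Z = d1%:Z + d2%:Z - 2]
    & exists e e1 e2 : int,
        [/\ is_multiplicity 'J_(K, G) e,
            is_multiplicity 'J_(K, G1) e1,
            is_multiplicity 'J_(K, G2) e2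
          & e = e1 * e2]].
Proof.
move=> GT [GV Gadj] [_ G1adj] [_ G2adj] Vv free1 free2.
have glue : glued (vset G1) (vset G2) v (adj G) set0.
  split; rewrite ?in_set0 //; first exact: adj_sym.
  - by move=> i j _ _; rewrite Gadj => /orP[] /adj_vset ->; rewrite ?orbT.
  - move=> i j; rewrite !inE !negbK => i1 j1 ij evi evj.
    have v1 : v \in vset G1 by have := set11 v; rewrite -Vv inE => /andP[].
    have := @free_vertex_simplicial _ G1 v i j free1 ij.
    by rewrite !G1adj v1 i1 j1 /=; apply.
  - move=> i j; rewrite !inE !negbK => i1 j1 ij evi evj.
    have v2 : v \in vset G2 by have := set11 v; rewrite -Vv inE => /andP[].
    have := @free_vertex_simplicial _ G2 v i j free2 ij.
    by rewrite !G2adj v2 i1 j1 /=; apply.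
have hilbE : (hilbert_series 'J_(K, G) : fser) =
    (1 - tser) ^+ 2 * ((hilbert_series 'J_(K, G1) : fser) * (hilbert_series 'J_(K, G2) : fser)).
  rewrite !hilbert_seriesE GT setCT (hser_glue K _ Vv glue) -?GV ?GT // !set0U.
  congr (_ * (_ * _)); apply: hser_off => i j; rewrite !inE !negbK => i1 j1 _.
    by rewrite G1adj i1 j1.
  by rewrite G2adj i1 j1.
have [d [Q [dimG HQ Q1]]] := bei_krull K G.
have [d1 [Q' [dimG1 HQ' Q1']]] := bei_krull K G1.
have [d2 [Q'' [dimG2 HQ'' Q1'']]] := bei_krull K G2.
(* Both sides equal (1 - t)^(d + d1 + d2) times the Hilbert series of G. *)
have polyE : (1 - 'X) ^+ (d1 + d2) * Q = (1 - 'X) ^+ (d + 2) * (Q' * Q'').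
  apply: toser_inj; rewrite !rmorphM !rmorphXn rmorphB rmorph1 /=.
  by rewrite -HQ -HQ' -HQ'' hilbE !exprD; ring.
have [dE QE] : (d1 + d2 = d + 2)%N /\ Q = Q' * Q''.
  by apply: s_valuation polyE; rewrite ?hornerM ?mulf_neq0.
have multI (H : sgraph n) d' R : is_krull_dim {ideal_quot 'J_(K, H)} d' ->
    (1 - tser) ^+ d' * (hilbert_series 'J_(K, H) : fser) = toser R ->
    is_multiplicity 'J_(K, H) R.[1].
  by move=> dimH HR; exists d', R; split=> //; rewrite -[RHS]HR -toser_s.
split.
- by rewrite [LHS]hilbE -toser_s.
- by exists d, d1, d2; split=> //; lia.
- exists Q.[1], Q'.[1], Q''.[1]; split.
  + exact: multI dimG HQ.
  + exact: multI dimG1 HQ'.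
  + exact: multI dimG2 HQ''.
  + by rewrite QE hornerM.
Qed.
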